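(* The problem Balanced Cluster Deletion (BCD), parameterized by $k$, admits a kernel with $\mathcal{O}(k^4)$ vertices: there is a polynomial-time algorithm that, given an instance $(G,k,\eta)$ of BCD, outputs an equivalent instance $(G',k',\eta')$ of BCD (a yes-instance if and only if $(G,k,\eta)$ is) with $|V(G')|=\mathcal{O}(k^4)$ and $k'\le k$.
   Context: All graphs are finite and simple. A cluster graph is a graph in which every connected component is a clique. For a non-negative integer $\eta$, a graph is $\eta$-balanced if for any two connected components $H,H'$ we have $\big||V(H)|-|V(H')|\big|\le\eta$. For $F\subseteq E(G)$, $G-F$ denotes the graph $(V(G),E(G)\setminus F)$. Balanced Cluster Deletion (BCD): given a graph $G$ and non-negative integers $k,\eta$, decide whether there is $F\subseteq E(G)$ with $|F|\le k$ such that $G-F$ is an $\eta$-balanced cluster graph. *)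

(* Defs.v *)
From mathcomp Require Import all_boot all_order all_algebra.

Set Implicit Arguments.
Unset Strict Implicit.
Unset Printing Implicit Defensive.

Record sgraph (T : finType) := SGraph {
  edges : {set {set T}};
  edges_card2 : [forall e in edges, #|e| == 2]
}.

Section Graphs.
Variables (T : finType) (G : sgraph T).

Definition adj : rel T := fun x y => [set x; y] \in edges G.

Lemma del_edges_card2 (F : {set {set T}}) :
  [forall e in edges G :\: F, #|e| == 2].
Proof.
apply/forall_inP => e /setDP[eG _].
exact: (forall_inP (edges_card2 G)).
Qed.

Definition del_edges (F : {set {set T}}) : sgraph T :=
  SGraph (del_edges_card2 F).

Definition components : {set {set T}} :=
  equivalence_partition (connect adj) [set: T].

Definition clique (H : {set T}) : Prop :=
  {in H &, forall x y, x != y -> adj x y}.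

Definition cluster_graph : Prop :=
  {in components, forall H : {set T}, clique H}.

Definition balanced (eta : nat) : Prop :=
  {in components &, forall H H' : {set T}, (`|#|H| - #|H'| | <= eta)%N}.

End Graphs.

Record bcd_instance := BCDInstance {
  nvert : nat;
  graph : sgraph 'I_nvert;
  param : nat;
  slack : nat
}.

Definition BCD (I : bcd_instance) : Prop :=
  exists F : {set {set 'I_(nvert I)}},
    [/\ F \subset edges (graph I), #|F| <= param I,
        cluster_graph (del_edges (graph I) F)
      & balanced (del_edges (graph I) F) (slack I)].

(* The Cook-Reckhow RAM: registers hold natural numbers, the input is a       *)
(* read-only and the output a write-only tape of natural numbers, and each    *)
(* instruction costs one step. Addition and truncated subtraction are the     *)
(* only arithmetic operations: t steps lengthen numbers by O(t) bits, so that *)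
(* polynomial time in the bit length of the input is the same notion as for   *)
(* Turing machines (unit-cost multiplication would break this).               *)
Inductive instr :=
  | Const (r v : nat)
  | Add (r a b : nat)
  | Sub (r a b : nat)
  | Fetch (r a : nat)
  | Store (r a : nat)
  | Read (r : nat)
  | Write (r : nat)
  | Jz (r l : nat).

Record config := Config {
  pc : nat;
  regs : nat -> nat;
  inp : seq nat;
  out : seq nat
}.

Definition upd (m : nat -> nat) (r v : nat) : nat -> nat :=
  fun a => if a == r then v else m a.

Definition exec (i : instr) (c : config) : config :=
  let: Config l m s o := c in
  match i with
  | Const r v => Config l.+1 (upd m r v) s o
  | Add r a b => Config l.+1 (upd m r (m a + m b)) s o
  | Sub r a b => Config l.+1 (upd m r (m a - m b)) s o
  | Fetch r a => Config l.+1 (upd m r (m (m a))) s o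
  | Store r a => Config l.+1 (upd m (m r) (m a)) s o
  | Read r => Config l.+1 (upd m r (head 0 s)) (behead s) o
  | Write r => Config l.+1 m s (rcons o (m r))
  | Jz r l' => Config (if m r == 0 then l' else l.+1) m s o
  end.

Definition halted (A : seq instr) (c : config) : bool := size A <= pc c.

Definition step (A : seq instr) (c : config) : config :=
  if onth A (pc c) is Some i then exec i c else c.

Definition init (s : seq nat) : config := Config 0 (fun=> 0) s [::].

Definition run (A : seq instr) (s : seq nat) (t : nat) : config :=
  iter t (step A) (init s).

Definition bitlen (m : nat) : nat := (trunc_log 2 m).+1.

Definition input_size (s : seq nat) : nat := sumn [seq bitlen m | m <- s].

(* The graph is given by its number of vertices and its adjacency matrix. *)
Definition encode (I : bcd_instance) : seq nat :=
  [:: nvert I, param I, slack I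
    & [seq nat_of_bool (adj (graph I) x y)
      | x <- enum 'I_(nvert I), y <- enum 'I_(nvert I)]].

(* A halted machine no longer moves, so the number of steps below is an upper *)
(* bound on the running time.                                                 *)
Definition polytime (f : bcd_instance -> bcd_instance) : Prop :=
  exists (A : seq instr) (P : {poly nat}), forall I : bcd_instance,
    let c := run A (encode I) (P.[input_size (encode I)])%R in
    halted A c /\ out c = encode (f I).

(* The bound is only asymptotic: a kernel of a no-instance has at least one   *)
(* vertex even when the parameter is 0, where k ^ 4 vanishes.                 *)
Definition bigO (g h : nat -> nat) : Prop :=
  exists C n0 : nat, forall n, n0 <= n -> g n <= C * h n.

(* Main.v *)
Require Import Defs.
From mathcomp Require Import all_boot all_order all_algebra zify.

(** Put c = 2k and let a solution be the partition into the final cliques, so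
    that at most c ordered pairs of adjacent vertices are cut.

    If the edge uw survives, every vertex adjacent to exactly one of u and w is
    cut off from it; hence edges whose end neighbourhoods differ in more than c
    further vertices must be deleted.  After deleting all of them at once, every
    final clique with at least t = 2c+3 vertices is a component of the remaining
    graph: a neighbour w outside such a clique sees at most c of its vertices,
    so the edges to w have been deleted.  Thus the vertices outside clique
    components lie in the at most c small final cliques that meet a cut pair,
    which bounds their number by t^2.

    A clique component with more than c vertices cannot be split.  Those with at
    least t vertices can therefore be trimmed to t vertices, lowering eta by the
    largest number of vertices removed from one of them: they only matter as the
    largest final cliques.  Restricting a solution to some components is again a
    solution; conversely, among c+1 clique components of the same size one is
    not split, so further components of this size can be added back unsplit.
    Keeping c+1 clique components of each size leaves O(k^3) vertices.

    Everything above is expressed by additions, truncated subtractions and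
    sums over all vertices, without iteration or connectivity tests.  Expressions
    of this form (with higher-order syntax for the summation variables) compile
    to RAM code whose running time is a polynomial in the number of vertices. *)

Set Implicit Arguments.
Unset Strict Implicit.
Unset Printing Implicit Defensive.

(** * Deletion sets as balanced clusterings *)

Section Clusterings.
Variable T : finType.
Implicit Types (A E : rel T) (S : {set T}).

Definition cut A S E : {set T * T} :=
  [set p | [&& p.1 \in S, p.2 \in S, A p.1 p.2 & ~~ E p.1 p.2]].

Definition cls E x : {set T} := [set y | E x y].

Definition clustering A S c E : Prop :=
  [/\ forall x, E x x = (x \in S), symmetric E, transitive E,
      forall x y, E x y -> x != y -> A x y
    & #|cut A S E| <= c].

Definition balanced_classes S eta E : Prop :=
  {in S &, forall x y, #|cls E x| <= #|cls E y| + eta}.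

Definition solvable A S c eta : Prop :=
  exists E, clustering A S c E /\ balanced_classes S eta E.

Lemma clustering_dom A S c E x y :
  clustering A S c E -> E x y -> (x \in S) && (y \in S).
Proof.
case=> Er Es Et _ _ Exy; rewrite -!Er (Et _ _ _ Exy) ?(Et y x x) // 1?Es //.
by apply: (Et x) => //; rewrite Es.
Qed.

Lemma solvable_ext A A' S c eta : A =2 A' ->
  solvable A S c eta -> solvable A' S c eta.
Proof.
move=> AA [E [[Er Es Et EA Ec] EB]]; exists E; split=> //; split=> // [x y|].
  by rewrite -AA; exact: EA.
by rewrite (_ : cut A' S E = cut A S E) //; apply/setP=> p; rewrite !inE AA.
Qed.

End Clusterings.

Lemma card_sym_pairs n (R : rel 'I_n) : symmetric R -> irreflexive R ->
  #|[set p | R p.1 p.2]| = #|[set p : 'I_n * 'I_n | (p.1 < p.2) && R p.1 p.2]|.*2.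
Proof.
move=> Rs Ri; pose L := [set p : 'I_n * 'I_n | (p.1 < p.2) && R p.1 p.2].
pose sw (p : 'I_n * 'I_n) := (p.2, p.1).
have sw_inj : injective sw by move=> [a b] [a' b'] [-> ->].
have -> : [set p | R p.1 p.2] = L :|: sw @: L.
  apply/setP=> -[x y]; rewrite !inE /=; apply/idP/idP => [Rxy|].
    case: (ltngtP x y) => [xy|yx|/ord_inj xy]; rewrite ?Rxy //=.
      by apply/imsetP; exists (y, x); rewrite ?inE //= yx Rs.
    by rewrite xy Ri in Rxy.
  case/orP=> [/andP[]//|/imsetP[[a b]]]; rewrite inE /= => /andP[_ Rab] [-> ->].
  by rewrite Rs.
rewrite cardsU card_imset // addnn (_ : _ :&: _ = set0) ?cards0 ?subn0 //.
apply/setP=> -[x y]; rewrite !inE /=; apply/negP=> /andP[/andP[xy _]].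
by case/imsetP=> -[a b]; rewrite inE /= => /andP[ab _] [xa yb]; subst; lia.
Qed.

Lemma set2_inj_lt n (x y x' y' : 'I_n) : x < y -> x' < y' ->
  [set x; y] = [set x'; y'] -> (x, y) = (x', y').
Proof.
move=> xy xy' e.
have := set21 x y; have := set22 x y; have := set21 x' y'.
rewrite -{1}e e !inE.
case/orP=> /eqP ex; case/orP=> /eqP ey; case/orP=> /eqP ez; subst => //; lia.
Qed.

Lemma adj_sym (T : finType) (G : sgraph T) : symmetric (adj G).
Proof. by move=> x y; rewrite /adj setUC. Qed.

Lemma adj_irr (T : finType) (G : sgraph T) : irreflexive (adj G).
Proof.
move=> x; apply/negP=> e; have := forall_inP (edges_card2 G) _ e.
by rewrite setUid cards1.
Qed.

Section Subgraph.
Variables (T : finType) (A : rel T) (S : {set T}).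
Let ev (i : 'I_#|S|) : T := enum_val i.

Section Restriction.
Variable E : rel T.
Hypothesis Edom : forall x y, E x y -> (x \in S) && (y \in S).
Let A' : rel 'I_#|S| := fun i j => A (ev i) (ev j).
Let E' : rel 'I_#|S| := fun i j => E (ev i) (ev j).

Let evP x : x \in S -> exists i, x = ev i.
Proof. by move=> xS; exists (enum_rank_in xS x); rewrite /ev enum_rankK_in. Qed.

Let evS i : ev i \in S. Proof. exact: enum_valP. Qed.

Lemma card_cls_restrict i : #|cls E' i| = #|cls E (ev i)|.
Proof.
rewrite -(card_imset _ (@enum_val_inj _ _ : injective ev)).
apply: eq_card => x; rewrite !inE; apply/imsetP/idP => [[j]|Ex].
  by rewrite inE => Eij ->.
have /andP[_ /evP[j xj]] := Edom Ex; exists j => //.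
by rewrite inE /E' -xj.
Qed.

Lemma card_cut_restrict : #|cut A' setT E'| = #|cut A S E|.
Proof.
pose f (p : 'I_#|S| * 'I_#|S|) := (ev p.1, ev p.2).
have f_inj : injective f by move=> [a b] [a' b'] [/enum_val_inj -> /enum_val_inj ->].
rewrite -(card_imset _ f_inj); apply: eq_card => -[x y]; rewrite !inE /=.
apply/imsetP/idP => [[[i j]]|].
  by rewrite !inE /= => /andP[Aij Eij] [-> ->]; rewrite !evS; apply/and4P.
case/and4P=> /evP[i ->] /evP[j ->] Aij Eij.
by exists (i, j); rewrite // !inE /=; apply/andP.
Qed.

Lemma clustering_restrict c : clustering A S c E <-> clustering A' setT c E'
   /\ symmetric E /\ transitive E.
Proof.
split=> [[Er Es Et EA Ec]|[[Er _ _ EA Ec] [Es Et]]].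
  split; last by [].
  split=> [i|i j|i j l|i j Eij ij|].
  - by rewrite /E' Er evS inE.
  - exact: Es.
  - exact: Et.
  - by apply: EA => //; rewrite (inj_eq enum_val_inj).
  - by rewrite card_cut_restrict.
split=> [x||||].
- apply/idP/idP => [/Edom/andP[]//|/evP[i ->]].
  by have := Er i; rewrite /E' inE.
- exact: Es.
- exact: Et.
- move=> x y Exy xy; have /andP[/evP[i xi] /evP[j yj]] := Edom Exy.
  rewrite xi yj in Exy xy *; apply: (EA i j) => //.
  by apply: contraNneq xy => ->.
- by rewrite -card_cut_restrict.
Qed.

Lemma balanced_restrict eta :
  balanced_classes S eta E <-> balanced_classes setT eta E'.
Proof.
split=> EB.
  by move=> i j _ _; rewrite !card_cls_restrict; apply: EB; exact: evS.
by move=> x y /evP[i ->] /evP[j ->]; rewrite -!card_cls_restrict; apply: EB; rewrite inE.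
Qed.

End Restriction.

Lemma solvable_restrict c eta :
  solvable (fun i j => A (ev i) (ev j)) setT c eta <-> solvable A S c eta.
Proof.
split=> [[E' [EC EB]]|[E [EC EB]]]; last first.
  have Ed := clustering_dom EC.
  exists (fun i j => E (ev i) (ev j)); split.
    by have [] := (clustering_restrict (fun x y => @Ed x y) c).1 EC.
  by apply/balanced_restrict => // x y; exact: Ed.
pose E : rel T := fun x y => [exists i, exists j, [&& ev i == x, ev j == y & E' i j]].
have EE i j : E (ev i) (ev j) = E' i j.
  apply/existsP/idP => [[a /existsP[b /and3P[]]]|Eij].
    by move=> /eqP/enum_val_inj -> /eqP/enum_val_inj ->.
  by exists i; apply/existsP; exists j; rewrite !eqxx.
have EP x y : E x y -> exists i j, [/\ x = ev i, y = ev j & E' i j].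
  by case/existsP=> i /existsP[j /and3P[/eqP<- /eqP<- ?]]; exists i, j.
have Ed x y : E x y -> (x \in S) && (y \in S).
  by move=> /EP[i [j [-> -> _]]]; rewrite !enum_valP.
have [Er Es Et EA Ec] := EC.
exists E; split.
  apply/(clustering_restrict Ed); split; [split|split].
  - by move=> i; rewrite EE Er !inE.
  - by move=> i j; rewrite !EE.
  - by move=> i j l; rewrite !EE; exact: Et.
  - by move=> i j; rewrite EE; exact: EA.
  - rewrite (_ : cut _ _ _ = cut (fun i j => A (ev i) (ev j)) setT E') //.
    by apply/setP=> p; rewrite !inE EE.
  - move=> x y; apply/idP/idP => /EP[i [j [-> -> Eij]]]; rewrite EE Es //.
  - move=> y x z /EP[i [j [-> -> Eij]]] /EP[a [b [/enum_val_inj <- -> Eab]]].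
    by rewrite EE (Et _ _ _ Eij).
apply/(balanced_restrict Ed) => i j _ _.
have cE a : #|cls (fun i j => E (ev i) (ev j)) a| = #|cls E' a|.
  by apply: eq_card => b; rewrite !inE EE.
by rewrite !cE; apply: EB; rewrite inE.
Qed.

End Subgraph.

Section Bridge.
Variables (n : nat) (G : sgraph 'I_n) (k eta : nat).

Lemma solvable_of_deletion (F : {set {set 'I_n}}) :
  #|F| <= k -> cluster_graph (del_edges G F) -> balanced (del_edges G F) eta ->
  solvable (adj G) setT k.*2 eta.
Proof.
move=> Fk FC FB; set H := del_edges G F in FC FB.
have cs : connect_sym (adj H) by apply: sym_connect_sym; apply: adj_sym.
have comp x : cls (connect (adj H)) x \in components H.
  by apply/imsetP; exists x; rewrite ?inE //; apply/setP=> y; rewrite !inE.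
exists (connect (adj H)); split; first split.
- by move=> x; rewrite connect0 inE.
- exact: cs.
- exact: connect_trans.
- move=> x y xy nxy; have : adj H x y.
    by apply: (FC _ (comp x)) => //; rewrite inE.
  by rewrite /adj inE => /andP[].
- pose R : rel 'I_n := fun x y => adj G x y && ~~ connect (adj H) x y.
  have -> : cut (adj G) setT (connect (adj H)) = [set p | R p.1 p.2].
    by apply/setP=> p; rewrite !inE.
  rewrite (@card_sym_pairs _ R); last 2 first.
  + by move=> x y; rewrite /R adj_sym cs.
  + by move=> x; rewrite /R adj_irr.
  rewrite leq_double; apply: leq_trans Fk.
  rewrite -(@card_in_imset _ _ (fun p : 'I_n * 'I_n => [set p.1; p.2])).
    apply/subset_leq_card/subsetP => e /imsetP[[x y]].
    rewrite inE /= => /and3P[_ Gxy cxy] ->; apply: contraNT cxy => nF.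
    by apply: connect1; rewrite /adj inE nF.
  move=> [x y] [x' y']; rewrite !inE /= => /andP[xy _] /andP[xy' _].
  exact: set2_inj_lt.
- move=> x y _ _; have := FB _ _ (comp x) (comp y); lia.
Qed.

Lemma deletion_of_solvable : solvable (adj G) setT k.*2 eta ->
  exists F : {set {set 'I_n}},
    [/\ F \subset edges G, #|F| <= k, cluster_graph (del_edges G F)
      & balanced (del_edges G F) eta].
Proof.
case=> E [[Er Es Et EA Ec] EB].
pose F := edges G :\: [set [set p.1; p.2] | p : 'I_n * 'I_n & E p.1 p.2].
have adjE x y : adj (del_edges G F) x y = E x y && (x != y).
  rewrite /adj !inE negb_and negbK; apply/andP/andP => [[/orP[]]|[Exy xy]].
  - case/imsetP=> -[a b]; rewrite inE /= => Eab xyab.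
    move=> /(forall_inP (edges_card2 G)); rewrite cards2 eqSS eqb1 => xy.
    split=> //; move: xy; have := set21 x y; have := set22 x y; rewrite xyab !inE.
    by case/orP=> /eqP -> /orP[]/eqP ->; rewrite ?eqxx // Es.
  - by move/negbTE=> ->.
  split; last exact: EA.
  by apply/orP; left; apply/imsetP; exists (x, y); rewrite ?inE.
have conE x y : connect (adj (del_edges G F)) x y = E x y.
  apply/idP/idP => [/connectP[p]|Exy].
    elim: p x => [|z p IH] x /=; first by move=> _ ->; rewrite Er inE.
    by rewrite adjE => /andP[/andP[Exz _] pz] /(IH _ pz); apply: Et.
  have [->//|xy] := eqVneq x y.
  by apply: connect1; rewrite adjE Exy.
have compP H : H \in components (del_edges G F) -> exists x, H = cls E x.
  by case/imsetP=> x _ ->; exists x; apply/setP=> y; rewrite !inE conE.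
exists F; split.
- exact: subsetDl.
- rewrite -leq_double; apply: leq_trans Ec.
  pose R : rel 'I_n := fun x y => adj G x y && ~~ E x y.
  have -> : cut (adj G) setT E = [set p | R p.1 p.2].
    by apply/setP=> p; rewrite !inE.
  rewrite (@card_sym_pairs _ R); last 2 first.
  + by move=> x y; rewrite /R adj_sym Es.
  + by move=> x; rewrite /R adj_irr.
  rewrite leq_double.
  apply: leq_trans (leq_imset_card (fun p : 'I_n * 'I_n => [set p.1; p.2]) _).
  apply/subset_leq_card/subsetP => e /setDP[eG nE].
  have /cards2P[x [y [xy ee]]] := forall_inP (edges_card2 G) _ eG.
  wlog lxy : x y xy ee / x < y.
    move=> W; case: (ltngtP x y) => [|yx|/ord_inj xy']; first exact: W.
      by apply: (W y x) => //; rewrite 1?eq_sym // setUC.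
    by rewrite xy' eqxx in xy.
  apply/imsetP; exists (x, y) => //; rewrite inE /= lxy /R /adj -ee eG /=.
  apply: contra nE => Exy; apply/imsetP; exists (x, y); rewrite ?inE //.
- move=> H /compP[z ->] x y; rewrite !inE => zx zy xy.
  by rewrite adjE xy andbT; apply: (Et z) => //; rewrite Es.
- move=> H H' /compP[x ->] /compP[y ->].
  have := EB x y; have := EB y x; rewrite !inE => /(_ isT isT) + /(_ isT isT); lia.
Qed.

End Bridge.

Lemma BCD_solvable I :
  BCD I <-> solvable (adj (graph I)) setT (param I).*2 (slack I).
Proof.
split=> [[F [_ Fk FC FB]]|]; first exact: solvable_of_deletion Fk FC FB.
exact: deletion_of_solvable.
Qed.

Section GraphOfRel.
Variables (n : nat) (R : rel 'I_n).

Definition rel_edges : {set {set 'I_n}} :=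
  [set [set p.1; p.2] | p : 'I_n * 'I_n & (p.1 != p.2) && R p.1 p.2].

Lemma rel_edges_card2 : [forall e in rel_edges, #|e| == 2].
Proof.
apply/forall_inP => _ /imsetP[[x y] + ->]; rewrite inE /= => /andP[xy _].
by rewrite cards2 xy.
Qed.

Definition graph_of_rel := SGraph rel_edges_card2.

Lemma adj_graph_of_rel : symmetric R -> irreflexive R -> adj graph_of_rel =2 R.
Proof.
move=> Rs Ri x y; apply/idP/idP => [Gxy|Rxy].
  have xy : x != y by apply: contraTneq Gxy => ->; rewrite adj_irr.
  case/imsetP: Gxy => -[a b]; rewrite inE /= => /andP[ab Rab] e.
  move: xy; have := set21 x y; have := set22 x y; rewrite e !inE.
  by case/orP=> /eqP -> /orP[]/eqP ->; rewrite ?eqxx // Rs.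
apply/imsetP; exists (x, y); rewrite ?inE //= Rxy andbT.
by apply: contraTneq Rxy => ->; rewrite Ri.
Qed.

End GraphOfRel.

(** * Capping and thinning out the clique components *)

Lemma card_ord_lt n t : #|[set j : 'I_n | j < t]| = minn t n.
Proof.
have [tn|/ltnW nt] := leqP t n.
  have winj : injective (widen_ord tn) by move=> a b [] /val_inj.
  rewrite (_ : [set j | _] = widen_ord tn @: setT) ?card_imset ?cardsT ?card_ord //.
  apply/setP=> j; rewrite inE; apply/idP/imsetP => [jt|[i _ ->] /=]; last exact: ltn_ord.
  by exists (Ordinal jt) => //; apply: val_inj.
rewrite (_ : [set j | _] = setT) ?cardsT ?card_ord //.
by apply/setP=> i; rewrite !inE; apply: leq_trans nt.
Qed.

Lemma card_lowest n (X : {set 'I_n}) t : t <= #|X| ->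
  #|[set w in X | #|[set z in X | z < w]| < t]| = t.
Proof.
move=> tX; set L := [set w in X | _]; apply/eqP; rewrite eqn_leq; apply/andP; split.
  rewrite leqNgt; apply/negP=> tL.
  have [w0 w0L] : exists w, w \in L by apply/set0Pn; rewrite -card_gt0; lia.
  case: (@arg_maxnP _ w0 (fun w => w \in L) (fun w => w : nat) w0L) => w wL wmax.
  have := wL; rewrite inE => /andP[_]; apply/negP; rewrite -leqNgt -ltnS.
  apply: leq_trans tL _; rewrite (cardsD1 w L) wL add1n ltnS.
  apply/subset_leq_card/subsetP => z; rewrite !inE => /andP[zw zL].
  rewrite (andP zL).1 /= ltn_neqAle zw /=; apply: wmax.
  by rewrite inE.
rewrite leqNgt; apply/negP=> Lt.
have [w0 w0L] : exists w, w \in X :\: L.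
  by apply/set0Pn; rewrite -card_gt0; have := cardsID L X; have := subset_leq_card (subsetIr X L); lia.
case: (@arg_minnP _ w0 (fun w => w \in X :\: L) (fun w => w : nat) w0L) => w.
rewrite !inE => /andP[wL wX] wmin; rewrite wX /= in wL; move/negP: wL; apply.
apply: leq_ltn_trans Lt; apply/subset_leq_card/subsetP => z.
rewrite !inE => /andP[zX zw]; rewrite zX /=; apply: contraLR zw => nz.
by rewrite -leqNgt; apply: wmin; rewrite !inE zX andbT /= nz.
Qed.

Section CliqueLemmas.
Variables (T : finType) (A : rel T) (S : {set T}) (c : nat) (E : rel T).
Hypothesis EC : clustering A S c E.

Lemma clustering_cls x y : E x y -> cls E x = cls E y.
Proof.
have [_ Es Et _ _] := EC => Exy; apply/setP=> z; rewrite !inE.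
by apply/idP/idP => ?; [apply: (Et x) => //; rewrite Es|apply: (Et y)].
Qed.

(* If x and y are separated, every vertex of X is cut off from x or from y. *)
Lemma clique_unsplit (X : {set T}) : X \subset S ->
  {in X &, forall x y, x != y -> A x y} -> c < #|X| -> {in X &, forall x y, E x y}.
Proof.
have [Er Es Et EA Ec] := EC => XS XA cX x y xX yX; apply: contraLR cX => nE.
rewrite -leqNgt; apply: leq_trans Ec.
pose f z := (if E x z then y else x, z).
have f_inj : injective f by move=> a b [_ ->].
rewrite -(card_imset _ f_inj); apply/subset_leq_card/subsetP => _ /imsetP[z zX ->].
have xS := subsetP XS _ xX; have yS := subsetP XS _ yX; have zS := subsetP XS _ zX.
rewrite !inE /f /=; case: ifP => Exz.
  have nyz : ~~ E y z by apply: contra nE => Eyz; apply: (Et z); rewrite // Es.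
  rewrite yS zS nyz andbT /=; apply: XA => //.
  by apply: contraNneq nyz => ->; rewrite Er.
rewrite xS zS Exz andbT /=; apply: XA => //.
by apply: contraFneq Exz => ->; rewrite Er.
Qed.

End CliqueLemmas.

Section Reduction.
Variables (n c eta : nat) (B : rel 'I_n).

Definition sdiff (R : rel 'I_n) (u w : 'I_n) := #|[set z | R u z (+) R w z]|.
Definition threshold := c.*2.+3.
Definition in_clique v := #|[set u | B v u && (2 < sdiff B v u)]| == 0.
Definition csize v := #|[set u | B v u]|.+1.
Definition huge_clique v := in_clique v && (threshold <= csize v).
Definition cap v := minn (csize v) threshold.
Definition nb v := [set u | (u == v) || B v u].
Definition excess :=
  #|[set j : 'I_n | [exists v, in_clique v && (threshold + j < csize v)]]|.
Definition nonclique := [set v | ~~ in_clique v].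
Definition unbalanced :=
  [exists u, exists v, [&& huge_clique u, huge_clique v & csize v + eta < csize u]].
Definition lowest (u : 'I_n) := [forall w : 'I_n, (w < u) ==> ~~ B u w].
Definition before (u v : 'I_n) :=
  [forall w : 'I_n, (w <= u) ==> ~~ ((w == v) || B v w)].
Definition rk v :=
  #|[set u | [&& in_clique u, lowest u, cap u == cap v & before u v]]|.
Definition pos (v : 'I_n) := #|[set w : 'I_n | (w < v) && B v w]|.
Definition kept :=
  [set v | ~~ in_clique v || (rk v <= c) && (pos v < threshold)].

Hypotheses (Bs : symmetric B) (Bi : irreflexive B).

Lemma nb_sym u v : (u \in nb v) = (v \in nb u).
Proof. by rewrite !inE eq_sym Bs. Qed.

Lemma nb_refl v : v \in nb v.
Proof. by rewrite inE eqxx. Qed.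

Lemma csizeE v : csize v = #|nb v|.
Proof.
rewrite /csize (_ : nb v = v |: [set u | B v u]); last by apply/setP=> u; rewrite !inE.
by rewrite cardsU1 inE Bi.
Qed.

Lemma in_cliqueP v :
  reflect (forall u, u \in nb v -> nb u = nb v) (in_clique v).
Proof.
apply: (iffP idP) => [|H].
  rewrite /in_clique cards_eq0 => /eqP/setP cl u; rewrite inE.
  have [->//|uv /= Bvu] := eqVneq u v.
  have := cl u; rewrite !inE Bvu /= => /negbT; rewrite -leqNgt => sd.
  have sub : [set v; u] \subset [set z | B v z (+) B u z].
    apply/subsetP=> z; rewrite !inE => /orP[]/eqP->.
      by rewrite Bi Bs Bvu.
    by rewrite Bi Bvu.
  have /eqP/setP e : [set v; u] == [set z | B v z (+) B u z].
    by rewrite eqEcard sub cards2 eq_sym uv.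
  apply/setP=> z; have := e z; rewrite !inE.
  have [->|zv] := eqVneq z v; first by rewrite Bs Bvu orbT.
  have [->|zu] := eqVneq z u; first by rewrite Bvu.
  by rewrite /=; case: (B v z); case: (B u z).
rewrite /in_clique cards_eq0; apply/eqP/setP=> u; rewrite !inE; apply/negP=> /andP[Bvu].
have uv : u != v by apply: contraTneq Bvu => ->; rewrite Bi.
have /H/setP e : u \in nb v by rewrite inE Bvu orbT.
apply/negP; rewrite -leqNgt.
have <- : #|[set v; u]| = 2 by rewrite cards2 eq_sym uv.
apply/subset_leq_card/subsetP => z; have := e z; rewrite !inE.
have [//|zv] := eqVneq z v; have [//|zu] := eqVneq z u.
by rewrite /= => ->; rewrite addbb.
Qed.

Lemma in_clique_nb v u : in_clique v -> u \in nb v -> nb u = nb v.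
Proof. by move/in_cliqueP => H /H. Qed.

Lemma in_clique_stable v u : u \in nb v -> in_clique u = in_clique v.
Proof.
suff W x y : y \in nb x -> in_clique x -> in_clique y.
  by move=> uv; apply/idP/idP; apply: W; rewrite // nb_sym.
move=> yx clx; apply/in_cliqueP => z; rewrite (in_clique_nb clx yx) => zx.
by rewrite (in_clique_nb clx zx).
Qed.

Lemma in_clique_adj v x y : in_clique v -> x \in nb v -> y \in nb v ->
  x != y -> B x y.
Proof.
move=> cl xv; rewrite -(in_clique_nb cl xv) inE => /orP[/eqP->|//].
by rewrite eqxx.
Qed.

Definition least v : 'I_n := [arg min_(u < v | u \in nb v) (u : nat)].

Lemma leastP v : least v \in nb v /\ forall u, u \in nb v -> least v <= u.
Proof. by rewrite /least; case: arg_minnP => [|u]; rewrite ?nb_refl. Qed.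

Lemma least_nb v u : nb u = nb v -> least u = least v.
Proof.
move=> e; apply/val_inj/eqP; rewrite eqn_leq.
by rewrite (leastP u).2 ?(leastP v).2 ?e ?(leastP v).1 // -e (leastP u).1.
Qed.

Lemma lowestE u : lowest u = (least u == u).
Proof.
apply/forallP/eqP => [H|e w].
  apply/val_inj/eqP; rewrite eqn_leq (leastP u).2 ?nb_refl //= leqNgt.
  have [+ _] := leastP u; rewrite inE; case/orP=> [/eqP->|Bu]; first by rewrite ltnn.
  by apply/negP=> lu; have := H (least u); rewrite lu Bu.
apply/implyP=> wu; apply/negP=> Buw; have := (leastP u).2 w.
by rewrite e inE Buw orbT leqNgt wu => /(_ isT).
Qed.

Lemma beforeE u v : before u v = (u < least v).
Proof.
apply/forallP/idP => [H|uv w].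
  rewrite ltnNge; apply/negP=> le; have := H (least v).
  by have [] := leastP v; rewrite inE le => ->.
apply/implyP=> wu; apply/negP=> wv; have := (leastP v).2 w.
by rewrite inE wv => /(_ isT); lia.
Qed.

Lemma cap_nb u v : nb u = nb v -> cap u = cap v.
Proof. by rewrite /cap !csizeE => ->. Qed.

Lemma rk_nb u v : nb u = nb v -> rk u = rk v.
Proof.
move=> e; apply: eq_card => w.
by rewrite !inE (cap_nb e) !beforeE (least_nb e).
Qed.

Lemma huge_stable v u : u \in nb v -> huge_clique u = huge_clique v.
Proof.
move=> uv; rewrite /huge_clique (in_clique_stable uv); case cl: (in_clique v) => //=.
by rewrite !csizeE (in_clique_nb cl uv).
Qed.

Lemma pos_nb v w : in_clique v -> w \in nb v -> pos w = #|[set z in nb v | z < w]|.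
Proof.
move=> cl wv; apply: eq_card => z; rewrite [LHS]inE [RHS]inE.
rewrite -(in_clique_nb cl wv) [z \in nb w]inE andbC; case: eqP => [->|//].
by rewrite ltnn !andbF.
Qed.

Lemma kept_nb v w : in_clique v -> rk v <= c -> w \in nb v ->
  (w \in kept) = (#|[set z in nb v | z < w]| < threshold).
Proof.
move=> cl rv wv; rewrite inE (in_clique_stable wv) cl /=.
by rewrite (rk_nb (in_clique_nb cl wv)) rv (pos_nb cl wv).
Qed.

Lemma kept_small v : in_clique v -> rk v <= c -> csize v <= threshold -> nb v \subset kept.
Proof.
move=> cl rv sv; apply/subsetP=> w wv; rewrite (kept_nb cl rv wv).
apply: leq_trans sv; rewrite csizeE; apply: proper_card; apply/properP; split.
  by apply/subsetP=> z; rewrite !inE => /andP[].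
by exists w => //; rewrite inE ltnn andbF.
Qed.

Lemma card_kept_huge v : huge_clique v -> rk v <= c -> #|nb v :&: kept| = threshold.
Proof.
move=> /andP[cl sv] rv; rewrite csizeE in sv; rewrite -{1}(card_lowest sv).
apply: eq_card => w; rewrite in_setI [RHS]inE; case wv: (w \in nb v) => //=.
exact: kept_nb.
Qed.

Lemma lowest_kept u : lowest u -> rk u <= c -> u \in kept.
Proof.
move=> /forallP lu ru; rewrite inE ru /= (_ : pos u = 0) ?orbT //.
apply/eqP; rewrite cards_eq0; apply/eqP/setP=> w; rewrite !inE.
by apply/negP=> /andP[wu]; apply/negP; apply: (implyP (lu w)).
Qed.

(* Among the cliques with the capped size of x and rank above c, the first
   one only has predecessors of rank at most c. *)
Lemma many_kept x : in_clique x -> c < rk x ->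
  exists2 U : {set 'I_n}, c < #|U| &
    forall u, u \in U -> [/\ in_clique u, lowest u, cap u = cap x & rk u <= c].
Proof.
move=> clx rx.
pose P y := [&& in_clique y, cap y == cap x & c < rk y].
have Px : P x by rewrite /P clx eqxx.
case: (@arg_minnP _ x P (fun y => least y : nat) Px) => y /and3P[cly /eqP cy ry] ymin.
exists [set u | [&& in_clique u, lowest u, cap u == cap y & before u y]] => // u.
rewrite inE => /and4P[clu lu /eqP cu]; rewrite beforeE => uy; split=> //.
  by rewrite cu.
rewrite leqNgt; apply/negP=> ru; have := ymin u; rewrite /P clu cu cy eqxx ru.
by move: lu; rewrite lowestE => /eqP-> /(_ isT); lia.
Qed.

Lemma many_huge_kept x : huge_clique x ->
  exists u, [/\ huge_clique u, u \in kept & rk u <= c].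
Proof.
move=> hx; have /andP[clx sx] := hx; have [rx|rx] := leqP (rk x) c.
  have lx := (leastP x).1; exists (least x).
  have rl : rk (least x) <= c by rewrite (rk_nb (in_clique_nb clx lx)).
  split=> //; first by rewrite (huge_stable lx).
  by apply: lowest_kept => //; rewrite lowestE (least_nb (in_clique_nb clx lx)).
have [U cU UP] := many_kept clx rx.
have [u uU] : exists u, u \in U by apply/set0Pn; rewrite -card_gt0; lia.
have [clu lu cu ru] := UP _ uU; exists u; split=> //; last exact: lowest_kept.
by rewrite /huge_clique clu /=; move: cu; rewrite /cap; lia.
Qed.

Lemma huge_excess v : huge_clique v -> csize v <= threshold + excess.
Proof.
move=> /andP[cl _]; rewrite -leq_subLR.
have sn : csize v <= n by rewrite csizeE -[n in _ <= n]card_ord max_card.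
have -> : csize v - threshold = minn (csize v - threshold) n by lia.
rewrite -card_ord_lt; apply/subset_leq_card/subsetP => j; rewrite !inE => ju.
by apply/existsP; exists v; rewrite cl /=; lia.
Qed.

Lemma excess_huge : 0 < excess -> exists2 v, huge_clique v & threshold + excess <= csize v.
Proof.
move=> e0; have [j] : exists j, j \in [set j : 'I_n | [exists v, in_clique v && (threshold + j < csize v)]].
  by apply/set0Pn; rewrite -card_gt0.
rewrite inE => /existsP[w /andP[clw sw]].
case: (@arg_maxnP _ w in_clique csize clw) => v clv vmax.
have sv : threshold < csize v by apply: leq_trans (vmax _ clw); lia.
exists v; first by rewrite /huge_clique clv ltnW.
rewrite -leq_subRL; last lia.
apply: leq_trans (geq_minl _ n); rewrite -card_ord_lt.
apply/subset_leq_card/subsetP => i; rewrite !inE => /existsP[u /andP[clu su]].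
have /= := vmax _ clu; lia.
Qed.

Lemma card_kept_le : #|kept| <= #|nonclique| + threshold.+1 * c.+1 * threshold.
Proof.
rewrite -(cardsID nonclique kept); apply: leq_add; first exact: subset_leq_card (subsetIr _ _).
pose f v : 'I_threshold.+1 * 'I_c.+1 * 'I_threshold :=
  (inord (cap v), inord (rk v), Ordinal (ltn_pmod (pos v) (isT : 0 < threshold))).
have -> : threshold.+1 * c.+1 * threshold = #|{: 'I_threshold.+1 * 'I_c.+1 * 'I_threshold}|.
  by rewrite !card_prod !card_ord.
rewrite -(@card_in_imset _ _ f) ?max_card // => v w; rewrite !inE !negbK.
move=> /andP[clv /=]; rewrite clv /= => /andP[rv pv] /andP[clw /=].
rewrite clw /= => /andP[rw pw] [].
have ce u : cap u < threshold.+1 by rewrite /cap; lia.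
move=> /(congr1 val); rewrite /= !inordK // => ecap.
move=> /(congr1 val); rewrite /= !inordK // => erk.
rewrite !modn_small // => epos.
have below x y : in_clique x -> cap x = cap y -> least x < least y -> rk x < rk y.
  move=> clx exy lxy; have lx := (leastP x).1.
  apply: proper_card; apply/properP; split.
    apply/subsetP=> u; rewrite !inE !beforeE exy => /and4P[-> -> -> /=].
    by move/ltn_trans; apply.
  exists (least x); rewrite !inE !beforeE ?lxy ?ltnn ?andbF //.
  rewrite (in_clique_stable lx) clx lowestE (cap_nb (in_clique_nb clx lx)) exy eqxx.
  by rewrite (least_nb (in_clique_nb clx lx)) eqxx.
have el : least v = least w.
  apply/val_inj; case: (ltngtP (least v) (least w)) => // l.
    by have := below _ _ clv ecap l; lia.
  by have := below _ _ clw (esym ecap) l; lia.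
have env : nb v = nb w.
  have lv := (leastP v).1; have lw := (leastP w).1.
  by rewrite -(in_clique_nb clv lv) el (in_clique_nb clw lw).
have wv : w \in nb v by rewrite env nb_refl.
have mono x y : x \in nb v -> y \in nb v -> x < y -> pos x < pos y.
  move=> xv yv xy; rewrite (pos_nb clv xv) (pos_nb clv yv).
  apply: proper_card; apply/properP; split.
    by apply/subsetP=> z; rewrite !inE => /andP[-> /=] /ltn_trans; apply.
  by exists x; rewrite !inE ?ltnn ?andbF // xy andbT; move: xv; rewrite inE.
apply/val_inj; case: (ltngtP v w) => // l.
  by have := mono _ _ (nb_refl v) wv l; lia.
by have := mono _ _ wv (nb_refl v) l; lia.
Qed.

End Reduction.

Lemma leq_card_bigcup (I T : finType) (J : {set I}) (F : I -> {set T}) :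
  #|\bigcup_(i in J) F i| <= \sum_(i in J) #|F i|.
Proof.
elim/big_rec2: _ => [|i m X _ IH]; first by rewrite cards0.
by rewrite cardsU; apply: leq_trans (leq_subr _ _) _; rewrite leq_add2l.
Qed.

Section ReductionCorrect.
Variables (n c c1 eta : nat) (B : rel 'I_n).
Hypotheses (Bs : symmetric B) (Bi : irreflexive B) (c1c : c1 <= c).
Hypothesis large_isolated : forall E x,
  clustering B setT c1 E -> threshold c <= #|cls E x| -> cls E x = nb B x.

Local Notation thr := (threshold c).
Local Notation nb := (nb B).
Local Notation in_clique := (in_clique B).
Local Notation csize := (csize B).
Local Notation huge := (huge_clique c B).
Local Notation kept := (kept c B).
Local Notation excess := (excess c B).

Section Whole.
Variable E : rel 'I_n.
Hypothesis EC : clustering B setT c1 E.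

Let cls_sub x : cls E x \subset nb x.
Proof.
have [_ _ _ EA _] := EC; apply/subsetP=> y; rewrite !inE => Exy.
by have [//|yx] := eqVneq y x; rewrite /= EA // eq_sym.
Qed.

Lemma cls_in_clique x : (forall y, E x y -> nb y = cls E x) -> in_clique x.
Proof.
have [Er _ _ _ _] := EC => H; have xx : nb x = cls E x by rewrite H // Er inE.
by apply/(in_cliqueP Bs Bi) => y; rewrite xx inE => /H.
Qed.

Lemma large_cls_huge x : thr <= #|cls E x| -> huge x.
Proof.
move=> tx; have cx := large_isolated EC tx; rewrite /huge csizeE // -cx tx andbT.
apply: cls_in_clique => y Exy; have cy := clustering_cls EC Exy.
by rewrite cy -(large_isolated EC) // -cy.
Qed.

Lemma huge_cls x : huge x -> cls E x = nb x.
Proof.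
move=> hx; have /andP[clx sx] := hx; rewrite csizeE // in sx.
apply/eqP; rewrite eqEsubset cls_sub; apply/subsetP=> y yx; rewrite inE.
apply: (clique_unsplit EC (subsetT (nb x))) (nb_refl _ _) yx => [u v ux vx|].
  exact: (in_clique_adj Bs Bi clx ux vx).
by move: sx; rewrite /threshold; lia.
Qed.

Lemma card_nonclique : #|nonclique B| <= thr * thr.
Proof.
have [Er Es Et EA Ec] := EC.
pose F (p : 'I_n * 'I_n) := if #|cls E p.1| <= thr then cls E p.1 else set0.
apply: (@leq_trans #|\bigcup_(p in cut B setT E) F p|).
  apply/subset_leq_card/subsetP => x; rewrite inE => nx.
  have sx : #|cls E x| <= thr.
    by rewrite leqNgt; apply: contra nx => /ltnW/large_cls_huge/andP[].
  have [y Exy [z Byz nE]] : exists2 y, E x y & exists2 z, B y z & ~~ E y z.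
    have [/existsP[y /andP[Exy /existsP[z /andP[Byz nE]]]]|H] :=
      boolP [exists y, E x y && [exists z, B y z && ~~ E y z]].
      by exists y => //; exists z.
    case/negP: nx; apply: cls_in_clique => y Exy.
    rewrite (clustering_cls EC Exy); apply/eqP; rewrite eqEsubset cls_sub andbT.
    apply/subsetP=> z; rewrite !inE => /orP[/eqP->|Byz]; first by rewrite Er inE.
    apply: contraR H => nE; apply/existsP; exists y; rewrite Exy.
    by apply/existsP; exists z; rewrite Byz.
  apply/bigcupP; exists (y, z); first by rewrite !inE /= Byz.
  by rewrite /F /= -(clustering_cls EC Exy) sx inE Er inE.
apply: leq_trans (leq_card_bigcup _ _) _.
apply: (@leq_trans (\sum_(p in cut B setT E) thr)).
  by apply: leq_sum => p _; rewrite /F; case: ifP; rewrite ?cards0.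
rewrite sum_nat_const leq_mul2r; apply/orP; right; apply: leq_trans Ec _.
by rewrite /threshold; lia.
Qed.

Lemma balanced_huge : balanced_classes setT eta E -> ~~ unbalanced c eta B.
Proof.
move=> EB; apply/existsP=> -[u /existsP[v /and3P[hu hv]]]; rewrite !csizeE //.
by have := EB u v; rewrite !inE -!huge_cls // => /(_ isT isT); lia.
Qed.

End Whole.

Lemma kept_nb_sub x : x \in kept -> ~~ huge x -> nb x \subset kept.
Proof.
rewrite {1}inE => /orP[clx _|/andP[rx _] hx].
  by apply/subsetP=> y yx; rewrite inE (in_clique_stable Bs Bi yx) clx.
have [clx|clx] := boolP (in_clique x).
  apply: kept_small => //; move: hx; rewrite /huge_clique clx /=; lia.
by apply/subsetP=> y yx; rewrite inE (in_clique_stable Bs Bi yx) clx.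
Qed.

Lemma solvable_kept : solvable B setT c1 eta -> solvable B kept c1 (eta - excess).
Proof.
case=> E [EC EB]; have [Er Es Et EA Ec] := EC.
pose E' : rel 'I_n := fun x y => [&& x \in kept, y \in kept & E x y].
have clsE x : x \in kept -> cls E' x = cls E x :&: kept.
  by move=> xk; apply/setP=> y; rewrite [LHS]in_set in_setI [y \in cls E x]in_set /E' xk /= andbC.
have clsS x : x \in kept -> ~~ huge x -> cls E' x = cls E x.
  move=> xk hx; rewrite clsE //; apply/setIidPl.
  apply: subset_trans (kept_nb_sub xk hx); apply/subsetP=> y; rewrite !inE => Exy.
  by have [//|yx] := eqVneq y x; rewrite /= EA // eq_sym.
have clsH x : x \in kept -> huge x -> #|cls E' x| = thr.
  move=> xk hx; rewrite clsE // huge_cls // card_kept_huge //.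
  by move: xk; have /andP[clx _] := hx; rewrite inE clx => /andP[].
have small x : ~~ huge x -> #|cls E x| < thr.
  by rewrite ltnNge; apply: contra => /(large_cls_huge EC).
exists E'; split; first split.
- by move=> x; rewrite /E' Er in_setT andbT andbb.
- by move=> x y; rewrite /E' andbCA Es.
- move=> y x z /and3P[xk _ xy] /and3P[_ zk yz].
  by rewrite /E' xk zk (Et _ _ _ xy).
- by move=> x y /and3P[_ _]; exact: EA.
- apply: leq_trans Ec; apply/subset_leq_card/subsetP => p.
  rewrite [p \in cut _ kept _]in_set [p \in cut _ _ _]in_set /E' => /and4P[-> -> -> /=].
  by rewrite !in_setT.
move=> x y xk yk; have [hy|hy] := boolP (huge y).
  rewrite (clsH y) //; have [hx|hx] := boolP (huge x); first by rewrite clsH // leq_addr.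
  by rewrite clsS //; have := small x hx; lia.
rewrite (clsS y) //.
have xt : #|cls E' x| <= thr.
  by have [hx|hx] := boolP (huge x); [rewrite clsH|rewrite clsS // ltnW ?small].
have xE : #|cls E' x| <= #|cls E x| by rewrite clsE //; apply/subset_leq_card/subsetIl.
have [e0|/excess_huge[v hv ve]] := posnP excess.
  by rewrite e0 subn0; apply: leq_trans xE (EB _ _ _ _); rewrite inE.
have := EB v y; rewrite !inE (huge_cls EC hv) -csizeE // => /(_ isT isT); lia.
Qed.

Section Extend.
Variable E : rel 'I_n.
Hypothesis EC : clustering B kept c1 E.

Let sub x y : E x y -> y \in nb x.
Proof.
have [_ _ _ EA _] := EC => Exy; rewrite inE.
by have [//|yx] := eqVneq y x; rewrite /= EA // eq_sym.
Qed.

Lemma huge_witness x : huge x -> exists2 y, y \in kept & #|cls E y| = thr.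
Proof.
move=> /(many_huge_kept Bs Bi)[u [hu uk ru]]; exists u => //.
rewrite -(card_kept_huge Bs Bi hu ru); have /andP[clu _] := hu.
congr #|pred_of_set _|; apply/eqP; rewrite eqEsubset; apply/andP; split; apply/subsetP=> y.
  rewrite inE => Euy; rewrite inE (sub Euy).
  by have /andP[] := clustering_dom EC Euy.
move=> yX; rewrite inE; apply: (clique_unsplit EC (subsetIr (nb u) kept)) yX.
- move=> a b; rewrite in_setI => /andP[au _]; rewrite in_setI => /andP[bu _].
  exact: (in_clique_adj Bs Bi clu au bu).
- by rewrite (card_kept_huge Bs Bi hu ru) /threshold; lia.
- by rewrite in_setI nb_refl.
Qed.

Lemma dropped_witness x : ~~ huge x -> x \notin kept ->
  exists2 y, y \in kept & #|cls E y| = csize x.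
Proof.
have [Er Es Et EA Ec] := EC.
move=> hx; rewrite inE negb_or negbK => /andP[clx nx].
have sx : csize x < thr by move: hx; rewrite /huge_clique clx /= ltnNge.
have rx : c < rk c B x.
  rewrite ltnNge; apply: contra nx => rx.
  have /subsetP/(_ x (nb_refl _ _)) := kept_small Bs Bi clx rx (ltnW sx).
  by rewrite inE clx.
have [U cU UP] := many_kept clx rx.
have [/existsP[u /andP[uU /eqP e]]|H] := boolP [exists u in U, cls E u == nb u].
  have [clu lu cu ru] := UP _ uU; exists u; first exact: lowest_kept.
  by rewrite e -csizeE //; move: cu; rewrite /cap; lia.
suff : #|U| <= #|cut B kept E| by lia.
apply: leq_trans (leq_imset_card fst _); apply/subset_leq_card/subsetP => u uU.
have [clu lu cu ru] := UP _ uU; have uk := lowest_kept lu ru.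
have nk : nb u \subset kept by apply: kept_small => //; move: cu; rewrite /cap; lia.
have : ~~ (nb u \subset cls E u).
  apply: contra H => ns; apply/existsP; exists u; rewrite uU eqEsubset ns andbT.
  by apply/subsetP=> y; rewrite inE => /sub.
case/subsetPn=> z zu nz; apply/imsetP; exists (u, z) => //.
rewrite inE /= uk (subsetP nk _ zu) /=; rewrite inE in nz; rewrite nz andbT.
move: zu; rewrite inE; case: eqP => [zu|//].
by rewrite zu Er uk in nz.
Qed.

Definition extension : rel 'I_n := fun x y =>
  if (x \in kept) && ~~ huge x then E x y else y \in nb x.

Lemma extensionE x y : y \in nb x ->
  (x \in kept) && ~~ huge x = (y \in kept) && ~~ huge y.
Proof.
suff W a b : b \in nb a -> (a \in kept) && ~~ huge a -> (b \in kept) && ~~ huge b.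
  by move=> yx; apply/idP/idP; apply: W => //; rewrite (nb_sym Bs).
move=> ba /andP[ak ha]; rewrite (huge_stable c Bs Bi ba) ha andbT.
exact: subsetP (kept_nb_sub ak ha) _ ba.
Qed.

Lemma extension_sub x y : extension x y -> y \in nb x.
Proof. by rewrite /extension; case: ifP => // _ /sub. Qed.

Lemma extension_clustering : clustering B setT c1 extension.
Proof.
have [Er Es Et EA Ec] := EC.
have clq x : ((x \in kept) && ~~ huge x) = false -> in_clique x.
  move=> h; apply: contraFT h => cx; rewrite inE cx /=.
  by rewrite /huge_clique (negbTE cx).
have sym x y : extension x y -> extension y x.
  move=> xy; have := xy; have yx := extension_sub xy; rewrite /extension (extensionE yx).
  by case: ifP => _; [rewrite Es|rewrite (nb_sym Bs)].
split.
- move=> x; rewrite inE /extension; case: ifP => [/andP[xk _]|_]; last exact: nb_refl.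
  by rewrite Er.
- by move=> x y; apply/idP/idP; exact: sym.
- move=> y x z xy; have := xy; have yx := extension_sub xy.
  rewrite /extension -(extensionE yx); case: ifP => [_|/clq clx _]; first exact: Et.
  by rewrite (in_clique_nb Bs Bi clx yx).
- move=> x y /extension_sub; rewrite inE; case: eqP => [->|//].
  by rewrite eqxx.
apply: leq_trans Ec; apply/subset_leq_card/subsetP => -[x y].
rewrite !in_set /= => /andP[Bxy]; have yx : y \in nb x by rewrite inE Bxy orbT.
rewrite /extension; case: ifP => h; last by rewrite yx.
have := h; rewrite (extensionE yx) => /andP[yk _]; case/andP: h => xk _ nE.
by rewrite -!(in_set (fun v => ~~ in_clique v || _)) Bxy nE xk yk.
Qed.

Lemma extension_witness x :
  if huge x then
    [/\ thr <= #|cls extension x| <= thr + excess,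
        #|cls extension x| = csize x
      & exists2 y, y \in kept & #|cls E y| = thr]
  else #|cls extension x| < thr /\
       exists2 y, y \in kept & #|cls E y| = #|cls extension x|.
Proof.
have EC' := extension_clustering.
case: ifP => hx.
  have e : #|cls extension x| = csize x by rewrite (huge_cls EC') // csizeE.
  split=> //; last exact: huge_witness hx.
  by rewrite e (huge_excess Bi hx) andbT; case/andP: hx.
split.
  by rewrite ltnNge; apply: contraFN hx; exact: large_cls_huge.
have [xk|xk] := boolP (x \in kept).
  exists x => //; congr #|pred_of_set _|; apply/setP=> y.
  by rewrite !inE /extension xk hx.
have [|y yk ey] := dropped_witness _ xk; first by rewrite hx.
exists y; rewrite // ey csizeE //; congr #|pred_of_set _|; apply/setP=> z.
by rewrite [RHS]inE /extension (negbTE xk).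
Qed.

End Extend.

Lemma solvable_of_kept : ~~ unbalanced c eta B ->
  solvable B kept c1 (eta - excess) -> solvable B setT c1 eta.
Proof.
move=> nb [E [EC EB]]; exists (extension E); split; first exact: extension_clustering.
move=> x y _ _; have := extension_witness EC x; have := extension_witness EC y.
case: ifP => hy; case: ifP => hx.
- move=> [_ -> _] [_ -> _]; rewrite leqNgt; apply: contra nb => h.
  by apply/existsP; exists x; apply/existsP; exists y; rewrite hx hy.
- by move=> [/andP[ty _] _ _] [xt _]; lia.
- move=> [yt [y' yk ey]] [/andP[_ tx] _ [x' xk ex]].
  by have := EB _ _ xk yk; rewrite ey ex; lia.
- move=> [yt [y' yk ey]] [xt [x' xk ex]].
  by have := EB _ _ xk yk; rewrite ey ex; lia.
Qed.

End ReductionCorrect.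

Section Pruning.
Variables (n k eta : nat) (A : rel 'I_n).

Definition pruned : rel 'I_n := fun u w => A u w && (sdiff A u w <= k.*2.+2).

Definition forced := #|[set p : 'I_n * 'I_n |
  (p.1 < p.2) && (A p.1 p.2 && ~~ pruned p.1 p.2)]|.

Definition infeasible :=
  [|| k < forced,
      minn (threshold k.*2) n * minn (threshold k.*2) n < #|nonclique pruned|
    | unbalanced k.*2 eta pruned].

Hypotheses (As : symmetric A) (Ai : irreflexive A).

Lemma pruned_sym : symmetric pruned.
Proof.
move=> x y; rewrite /pruned As; congr (_ && (_ <= _)); apply: eq_card => z.
by rewrite !inE addbC.
Qed.

Lemma pruned_irr : irreflexive pruned.
Proof. by move=> x; rewrite /pruned Ai. Qed.

Section Clustered.
Variable E : rel 'I_n.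
Hypothesis EC : clustering A setT k.*2 E.

(* A vertex adjacent to exactly one of x and y is cut off from that one. *)
Lemma clustering_pruned x y : E x y -> x != y -> pruned x y.
Proof.
have [Er Es Et EA Ec] := EC => Exy xy; rewrite /pruned EA //= /sdiff.
set Z := [set z | _].
have ZD : #|Z :\: [set x; y]| <= k.*2.
  apply: leq_trans Ec; pose f z := (if A x z then x else y, z).
  have f_inj : injective f by move=> a b [_ ->].
  rewrite -(card_imset _ f_inj); apply/subset_leq_card/subsetP => _ /imsetP[z + ->].
  rewrite !inE negb_or => /andP[/andP[zx zy]]; rewrite /f; case: ifP => /= Axz Ayz.
    rewrite Axz /=; apply: contra Ayz => Exz; apply: EA; last by rewrite eq_sym.
    by apply: (Et x) => //; rewrite Es.
  rewrite Ayz /=; apply: contraFN Axz => Eyz; apply: EA; last by rewrite eq_sym.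
  exact: (Et y).
have := cardsID [set x; y] Z; have := subset_leq_card (subsetIr Z [set x; y]).
by rewrite cards2 xy; lia.
Qed.

(* An outside neighbour w of x sees at most 2k vertices of the class of x, so
   the neighbourhoods of x and w differ too much for the edge to survive. *)
Lemma clustering_isolated x : threshold k.*2 <= #|cls E x| -> cls E x = nb pruned x.
Proof.
have [Er Es Et EA Ec] := EC => tx; apply/setP=> w; rewrite !inE.
have [->|wx /=] := eqVneq w x; first by rewrite Er inE.
apply/idP/idP => [Exw|]; first by rewrite clustering_pruned // eq_sym.
apply: contraLR => nE; rewrite /pruned; case Axw: (A x w) => //=; rewrite -ltnNge.
have seen : #|cls E x :&: [set z | A w z]| <= k.*2.
  apply: leq_trans Ec; pose f (z : 'I_n) := (w, z).
  have f_inj : injective f by move=> a b [].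
  rewrite -(card_imset _ f_inj); apply/subset_leq_card/subsetP => _ /imsetP[z + ->].
  rewrite !inE /= => /andP[Exz ->] /=; apply: contra nE => Ewz.
  by apply: (Et z) => //; rewrite Es.
have unseen : #|cls E x :\: [set z | A w z]| <= sdiff A x w.
  apply/subset_leq_card/subsetP => z; rewrite !inE => /andP[nA Exz].
  rewrite (negbTE nA) addbF; apply: EA => //.
  by apply: contraNneq nA => <-; rewrite As.
by have := cardsID [set z | A w z] (cls E x); move: tx; rewrite /threshold; lia.
Qed.

End Clustered.

Lemma card_cut_pruned (E : rel 'I_n) : (forall x y, E x y -> x != y -> pruned x y) ->
  #|cut A setT E| = #|cut pruned setT E| + forced.*2.
Proof.
move=> EP; pose R : rel 'I_n := fun x y => A x y && ~~ pruned x y.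
have <- : #|[set p | R p.1 p.2]| = forced.*2.
  rewrite card_sym_pairs // => [x y|x]; first by rewrite /R As pruned_sym.
  by rewrite /R Ai.
rewrite -(cardsID [set p | R p.1 p.2] (cut A setT E)) addnC.
congr (_ + _); apply: eq_card => -[x y]; rewrite !inE /R /=.
  case P: (pruned x y); last by case: (A x y).
  by have /andP[-> _] := P.
case Axy: (A x y) => //=; case P: (pruned x y); rewrite ?andbF //= andbT.
apply: contraFN P => Exy; apply: EP => //.
by apply: contraTneq Axy => ->; rewrite Ai.
Qed.

Lemma solvable_pruned : solvable A setT k.*2 eta <->
  forced <= k /\ solvable pruned setT (k - forced).*2 eta.
Proof.
split=> [[E [EC EB]]|[fk [E [EC EB]]]]; have [Er Es Et EA Ec] := EC.
  have EP := clustering_pruned EC; move: Ec; rewrite card_cut_pruned // => Ec.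
  split; first by lia.
  by exists E; split=> //; split=> //; lia.
exists E; split=> //; split=> // [x y Exy xy|]; first by have /andP[] := EA _ _ Exy xy.
by rewrite card_cut_pruned //; lia.
Qed.

Lemma pruned_large_isolated E x : forced <= k ->
  clustering pruned setT (k - forced).*2 E -> threshold k.*2 <= #|cls E x| ->
  cls E x = nb pruned x.
Proof.
move=> fk [Er Es Et EA Ec]; apply: clustering_isolated; split=> //.
  by move=> y z Eyz yz; have /andP[] := EA _ _ Eyz yz.
by rewrite card_cut_pruned //; lia.
Qed.

Lemma infeasible_unsolvable : infeasible -> ~ solvable A setT k.*2 eta.
Proof.
move=> inf /solvable_pruned[fk [E [EC EB]]].
have iso E' x := @pruned_large_isolated E' x fk.
have ck : (k - forced).*2 <= k.*2 by lia.
move: inf; rewrite /infeasible ltnNge fk /= => /orP[|]; apply/negP; last first.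
  exact: (balanced_huge pruned_sym pruned_irr ck EC).
rewrite -leqNgt; have [tn|nt] := leqP (threshold k.*2) n.
  exact: (card_nonclique pruned_sym pruned_irr ck iso EC).
apply: leq_trans (max_card _) _; rewrite card_ord.
by case: (n) => // m; rewrite leq_pmulr.
Qed.

Lemma solvable_reduced : ~~ infeasible ->
  solvable pruned (kept k.*2 pruned) (k - forced).*2 (eta - excess k.*2 pruned)
  <-> solvable A setT k.*2 eta.
Proof.
rewrite /infeasible !negb_or -leqNgt => /and3P[fk _ nu].
have iso E' x := @pruned_large_isolated E' x fk.
have ck : (k - forced).*2 <= k.*2 by lia.
rewrite solvable_pruned; split=> [s|[_ s]].
  by split=> //; exact: (solvable_of_kept pruned_sym pruned_irr ck iso nu).
exact: (solvable_kept pruned_sym pruned_irr ck iso).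
Qed.

Lemma card_reduced : ~~ infeasible ->
  #|kept k.*2 pruned| <= threshold k.*2 * threshold k.*2 + (threshold k.*2).+1 * k.*2.+1 * threshold k.*2.
Proof.
rewrite /infeasible !negb_or -!leqNgt => /and3P[_ Q _].
apply: leq_trans (card_kept_le _ pruned_sym pruned_irr) _; rewrite leq_add2r.
apply: leq_trans Q _; apply: leq_mul; exact: geq_minl.
Qed.

End Pruning.

(** * Compiling structured code to the RAM *)

Inductive code :=
  | Op (i : instr)
  | Sq (c1 c2 : code)
  | Br (r : nat) (c1 c2 : code)
  | Wh (r : nat) (c : code).

Fixpoint clen (c : code) : nat :=
  match c with
  | Op _ => 1
  | Sq c1 c2 => clen c1 + clen c2
  | Br _ c1 c2 => (clen c1 + clen c2).+2
  | Wh _ c => (clen c).+2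
  end.

(* Register 0 is never written, so [Jz 0] is an unconditional jump. *)
Fixpoint asm (l : nat) (c : code) : seq instr :=
  match c with
  | Op i => [:: i]
  | Sq c1 c2 => asm l c1 ++ asm (l + clen c1) c2
  | Br r c1 c2 =>
      Jz r (l + clen c1).+2 :: asm l.+1 c1 ++
      Jz 0 (l + clen c1 + clen c2).+2 :: asm (l + clen c1).+2 c2
  | Wh r c => Jz r (l + clen c).+2 :: asm l.+1 c ++ [:: Jz 0 l]
  end.

Lemma size_asm l c : size (asm l c) = clen c.
Proof.
elim: c l => //= [c1 IH1 c2 IH2 l|r c1 IH1 c2 IH2 l|r c IH l].
- by rewrite size_cat IH1 IH2.
- by rewrite size_cat /= IH1 IH2 addnS.
- by rewrite size_cat /= IH addn1.
Qed.

Definition state : Type := (nat -> nat) * seq nat * seq nat.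

Definition at_pc (l : nat) (st : state) : config :=
  Config l st.1.1 st.1.2 st.2.

Definition act (i : instr) (st : state) : state :=
  let: Config _ m s o := exec i (at_pc 0 st) in (m, s, o).

Definition is_jump (i : instr) : bool := if i is Jz _ _ then true else false.

Inductive bigstep : code -> state -> nat -> state -> Prop :=
  | bs_op i st : ~~ is_jump i -> bigstep (Op i) st 1 (act i st)
  | bs_sq c1 c2 st t1 st1 t2 st2 :
      bigstep c1 st t1 st1 -> bigstep c2 st1 t2 st2 ->
      bigstep (Sq c1 c2) st (t1 + t2) st2
  | bs_br1 r c1 c2 st t st1 :
      st.1.1 r != 0 -> bigstep c1 st t st1 -> st1.1.1 0 = 0 ->
      bigstep (Br r c1 c2) st t.+2 st1
  | bs_br0 r c1 c2 st t st1 :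
      st.1.1 r = 0 -> bigstep c2 st t st1 -> bigstep (Br r c1 c2) st t.+1 st1
  | bs_wh0 r c st : st.1.1 r = 0 -> bigstep (Wh r c) st 1 st
  | bs_wh r c st t1 st1 t2 st2 :
      st.1.1 r != 0 -> bigstep c st t1 st1 -> st1.1.1 0 = 0 ->
      bigstep (Wh r c) st1 t2 st2 -> bigstep (Wh r c) st (t1 + t2).+2 st2.

Definition segment (A : seq instr) (l : nat) (s : seq instr) : Prop :=
  exists p q, A = p ++ s ++ q /\ size p = l.

Lemma segment_catl A l s1 s2 : segment A l (s1 ++ s2) -> segment A l s1.
Proof. by case=> p [q [-> <-]]; exists p, (s2 ++ q); rewrite -!catA. Qed.

Lemma segment_catr A l s1 s2 :
  segment A l (s1 ++ s2) -> segment A (l + size s1) s2.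
Proof. by case=> p [q [-> <-]]; exists (p ++ s1), q; rewrite -!catA size_cat. Qed.

Lemma segment_cons A l i s : segment A l (i :: s) -> segment A l.+1 s.
Proof. by move/(@segment_catr A l [:: i]); rewrite addn1. Qed.

Lemma segment_step A l i s st : segment A l (i :: s) ->
  step A (at_pc l st) = exec i (at_pc l st).
Proof.
case=> p [q [-> <-]]; rewrite /step /= onth_cat ltnn subnn //.
Qed.

Lemma exec_act i l st : ~~ is_jump i -> exec i (at_pc l st) = at_pc l.+1 (act i st).
Proof. by case: i => [r v|r a b|r a b|r a|r a|r|r|r l']. Qed.

Lemma bigstep_run c st t st' : bigstep c st t st' ->
  forall A l, segment A l (asm l c) ->
  iter t (step A) (at_pc l st) = at_pc (l + clen c) st'.
Proof.
elim=> {c st t st'}.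
- move=> i st ni A l sg /=; rewrite (segment_step st sg) exec_act //.
  by rewrite addn1.
- move=> c1 c2 st t1 st1 t2 st2 _ IH1 _ IH2 A l /= sg.
  rewrite addnC iterD (IH1 _ _ (segment_catl sg)) addnA; apply: IH2.
  by have := segment_catr sg; rewrite size_asm.
- move=> r c1 c2 st t st1 nr _ IH st10 A l sg; rewrite /= in sg.
  rewrite (_ : t.+2 = 1 + (t + 1)) ?iterD /=; last lia.
  rewrite (segment_step st sg) /= (negbTE nr) -/(at_pc l.+1 st).
  have sg1 : segment A l.+1 (asm l.+1 c1 ++ Jz 0 (l + clen c1 + clen c2).+2 :: asm (l + clen c1).+2 c2).
    exact: segment_cons sg.
  rewrite (IH _ _ (segment_catl sg1)).
  have := segment_catr sg1; rewrite size_asm => sg2.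
  rewrite (segment_step st1 sg2) /= st10 eqxx /at_pc; congr Config; lia.
- move=> r c1 c2 st t st1 r0 _ IH A l sg; rewrite /= in sg; rewrite -addn1 iterD /=.
  rewrite (segment_step st sg) /= r0 eqxx -/(at_pc _ st) IH; last first.
    by have := segment_cons (segment_catr (segment_cons sg)); rewrite size_asm.
  by rewrite /at_pc; congr Config; lia.
- move=> r c st r0 A l /= sg; rewrite (segment_step st sg) /= r0 eqxx.
  by rewrite -/(at_pc _ st) !addnS.
- move=> r c st t1 st1 t2 st2 nr _ IH1 st10 _ IH2 A l sg; rewrite /= in sg.
  have e : (t1 + t2).+2 = t2 + (1 + (t1 + 1)) by lia.
  rewrite e iterD iterD iterD [iter 1]lock /= -lock /=.
  rewrite (segment_step st sg) /= (negbTE nr) -/(at_pc l.+1 st).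
  have sg1 : segment A l.+1 (asm l.+1 c ++ [:: Jz 0 l]).
    exact: segment_cons sg.
  rewrite (IH1 _ _ (segment_catl sg1)).
  have := segment_catr sg1; rewrite size_asm => sg2.
  rewrite (segment_step st1 sg2) /= st10 eqxx -/(at_pc l st1).
  exact: IH2.
Qed.

Definition loop (i : nat) (c : code) : code :=
  Sq (Op (Const i 0)) (Sq (Op (Defs.Sub i.+1 2 i))
    (Wh i.+1 (Sq c (Sq (Op (Add i i 1)) (Op (Defs.Sub i.+1 2 i)))))).

Definition consts (N : nat) (m : nat -> nat) : Prop :=
  [/\ m 0 = 0, m 1 = 1 & m 2 = N].

Section Loop.
Variables (i : nat) (c : code) (N tb : nat).
Variable (I : nat -> state -> Prop).
Hypothesis i2 : 2 < i.
Hypothesis I_consts : forall j st, I j st -> consts N st.1.1.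
Hypothesis I_frame : forall j m m' s o, I j (m, s, o) ->
  (forall r, r != i -> r != i.+1 -> m' r = m r) -> I j (m', s, o).
Hypothesis body : forall j st, j < N -> I j st -> st.1.1 i = j ->
  exists t st', [/\ bigstep c st t st', t <= tb, I j.+1 st' & st'.1.1 i = j].

Lemma loop_ok st : I 0 st ->
  exists t st', [/\ bigstep (loop i c) st t st', t <= N * (tb + 4) + 3 & I N st'].
Proof.
have iter_ok k j st0 : j + k = N -> I j st0 -> st0.1.1 i = j -> st0.1.1 i.+1 = N - j ->
  exists t st', [/\ bigstep (Wh i.+1 (Sq c (Sq (Op (Add i i 1)) (Op (Defs.Sub i.+1 2 i))))) st0 t st',
    t <= k * (tb + 4) + 1 & I N st'].
  elim: k j st0 => [|k IH] j st0.
    rewrite addn0 => -> Ij _; rewrite subnn => z.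
    by exists 1, st0; split=> //; apply: bs_wh0.
  move=> jk Ij ij zj; have jN : j < N by lia.
  have [t [[[m s] o] [bs tt' I' ij']]] := body jN Ij ij.
  have [m0 m1 m2] := I_consts I'; rewrite /= in m0 m1 m2 ij'.
  pose st2 := act (Defs.Sub i.+1 2 i) (act (Add i i 1) (m, s, o)).
  have [e1 e2] : (2 == i) = false /\ (1 == i) = false by split; apply/negP; lia.
  have I2 : I j.+1 st2.
    by apply: I_frame I' _ => r ri ri1; rewrite /= /upd (negbTE ri) (negbTE ri1).
  have m2i : st2.1.1 i = j.+1.
    by rewrite /= /upd ltn_eqF // eqxx m1 ij' addn1.
  have m2t : st2.1.1 i.+1 = N - j.+1.
    by rewrite /= /upd !eqxx e1 m2 m1 ij' addn1.
  have [t' [st' [bs' tt2 IN]]] := IH j.+1 st2 ltac:(lia) I2 m2i m2t.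
  exists ((t + (1 + 1)) + t').+2, st'; split=> //; last by rewrite mulSn; lia.
  apply: bs_wh bs'.
  - by rewrite zj -lt0n subn_gt0.
  - by apply: bs_sq bs _; apply: bs_sq; exact: bs_op.
  - by have [] := I_consts I2.
case: st => [[m s] o] I0.
pose st2 := act (Defs.Sub i.+1 2 i) (act (Const i 0) (m, s, o)).
have [m0 m1 m2] := I_consts I0; rewrite /= in m0 m1 m2.
have e1 : (2 == i) = false by apply/negP; lia.
have [|||t [st' [bs tt' IN]]] := iter_ok N 0 st2 (add0n N).
- by apply: I_frame I0 _ => r ri ri1; rewrite /= /upd (negbTE ri) (negbTE ri1).
- by rewrite /= /upd ltn_eqF // eqxx.
- by rewrite /= /upd !eqxx e1 m2.
exists (1 + (1 + t)), st'; split=> //; last lia.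
by apply: bs_sq; [exact: bs_op|apply: bs_sq bs; exact: bs_op].
Qed.

End Loop.

Inductive exp (V : Type) : Type :=
  | Cst (v : nat)
  | Var (x : V)
  | Plus (a b : exp V)
  | Minus (a b : exp V)
  | Mat (a : exp V)
  | Sum (f : V -> exp V).

Inductive cmd (V : Type) : Type :=
  | Skip
  | Wr (e : exp V)
  | Then (a b : cmd V)
  | If (e : exp V) (a b : cmd V)
  | For (f : V -> cmd V).

Arguments Cst {V} v.
Arguments Skip {V}.

Section Semantics.
Variables (N : nat) (M : nat -> nat).

Fixpoint eval (e : exp nat) : nat :=
  match e with
  | Cst v => v
  | Var x => x
  | Plus a b => eval a + eval b
  | Minus a b => eval a - eval b
  | Mat a => M (eval a)
  | Sum f => \sum_(x < N) eval (f x)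
  end.

Fixpoint output (c : cmd nat) : seq nat :=
  match c with
  | Skip => [::]
  | Wr e => [:: eval e]
  | Then a b => output a ++ output b
  | If e a b => if eval e == 0 then output b else output a
  | For f => flatten [seq output (f x) | x <- iota 0 N]
  end.

End Semantics.

Section Compiler.
Variable B : nat.

(* Register 5 holds the base address B of the matrix. The code for an
   expression leaves its value in register d and writes only registers in
   [d, B); the variables in scope live in registers below d. *)
Fixpoint compile (d : nat) (e : exp nat) : code :=
  match e with
  | Cst v => Op (Const d v)
  | Var x => Op (Add d x 0)
  | Plus a b => Sq (compile d a) (Sq (compile d.+1 b) (Op (Add d d d.+1)))
  | Minus a b => Sq (compile d a) (Sq (compile d.+1 b) (Op (Defs.Sub d d d.+1)))
  | Mat a => Sq (compile d a) (Sq (Op (Add d d 5)) (Op (Fetch d d)))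
  | Sum f => Sq (Op (Const d 0))
      (loop d.+1 (Sq (compile d.+3 (f d.+1)) (Op (Add d d d.+3))))
  end.

Fixpoint fits (d : nat) (e : exp nat) : bool :=
  match e with
  | Cst _ | Var _ => d < B
  | Plus a b | Minus a b => fits d a && fits d.+1 b
  | Mat a => fits d a
  | Sum f => (d.+2 < B) && fits d.+3 (f d.+1)
  end.

Fixpoint cost (d : nat) (e : exp nat) (N : nat) : nat :=
  match e with
  | Cst _ | Var _ => 1
  | Plus a b | Minus a b => cost d a N + cost d.+1 b N + 1
  | Mat a => cost d a N + 2
  | Sum f => N * (cost d.+3 (f d.+1) N + 1 + 4) + 4
  end.

Fixpoint compile_cmd (d : nat) (c : cmd nat) : code :=
  match c with
  | Skip => Op (Const d 0)
  | Wr e => Sq (compile d e) (Op (Write d))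
  | Then a b => Sq (compile_cmd d a) (compile_cmd d b)
  | If e a b => Sq (compile d e) (Br d (compile_cmd d a) (compile_cmd d b))
  | For f => loop d (compile_cmd d.+2 (f d))
  end.

Fixpoint fits_cmd (d : nat) (c : cmd nat) : bool :=
  match c with
  | Skip => d < B
  | Wr e => fits d e
  | Then a b => fits_cmd d a && fits_cmd d b
  | If e a b => [&& fits d e, fits_cmd d a & fits_cmd d b]
  | For f => (d.+1 < B) && fits_cmd d.+2 (f d)
  end.

Fixpoint cost_cmd (d : nat) (c : cmd nat) (N : nat) : nat :=
  match c with
  | Skip => 1
  | Wr e => cost d e N + 1
  | Then a b => cost_cmd d a N + cost_cmd d b N
  | If e a b => cost d e N + (cost_cmd d a N + cost_cmd d b N + 2)
  | For f => N * (cost_cmd d.+2 (f d) N + 4) + 3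
  end.

(* A pair (v, r) relates the value v of a variable to its register r. *)
Inductive wf (G : seq (nat * nat)) : exp nat -> exp nat -> Prop :=
  | wf_cst v : wf G (Cst v) (Cst v)
  | wf_var v r : (v, r) \in G -> wf G (Var v) (Var r)
  | wf_plus a b a' b' : wf G a a' -> wf G b b' -> wf G (Plus a b) (Plus a' b')
  | wf_minus a b a' b' : wf G a a' -> wf G b b' -> wf G (Minus a b) (Minus a' b')
  | wf_mat a a' : wf G a a' -> wf G (Mat a) (Mat a')
  | wf_sum f f' : (forall v r, wf ((v, r) :: G) (f v) (f' r)) ->
      wf G (Sum f) (Sum f').

Inductive wf_cmd (G : seq (nat * nat)) : cmd nat -> cmd nat -> Prop :=
  | wf_cmd_skip : wf_cmd G Skip Skip
  | wf_cmd_wr e e' : wf G e e' -> wf_cmd G (Wr e) (Wr e')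
  | wf_cmd_then a b a' b' : wf_cmd G a a' -> wf_cmd G b b' -> wf_cmd G (Then a b) (Then a' b')
  | wf_cmd_if e e' a b a' b' : wf G e e' -> wf_cmd G a a' -> wf_cmd G b b' ->
      wf_cmd G (If e a b) (If e' a' b')
  | wf_cmd_for f f' : (forall v r, wf_cmd ((v, r) :: G) (f v) (f' r)) ->
      wf_cmd G (For f) (For f').

Variables (N : nat) (M : nat -> nat).

Definition base (m : nat -> nat) : Prop :=
  [/\ consts N m, m 5 = B & forall j, m (B + j) = M j].

Definition env (G : seq (nat * nat)) (d : nat) (m : nat -> nat) : Prop :=
  forall v r, (v, r) \in G -> m r = v /\ r < d.

Definition agree (d : nat) (m m' : nat -> nat) : Prop :=
  forall r, (r < d) || (B <= r) -> m' r = m r.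

Lemma agree_trans d d' m m' m'' : d <= d' ->
  agree d m m' -> agree d' m' m'' -> agree d m m''.
Proof.
move=> dd h h' r hr; rewrite h'; first exact: h.
by case/orP: hr => [rd|->]; rewrite ?orbT // (leq_trans rd).
Qed.

Lemma agree_upd d r v m : d <= r -> r < B -> agree d m (upd m r v).
Proof. by move=> dr rB a ad; rewrite /upd; case: eqP => // e; subst; lia. Qed.

Lemma base_agree d m m' : 6 <= d -> agree d m m' -> base m -> base m'.
Proof.
move=> d6 h [[m0 m1 m2] m5 mB]; split.
- by split; rewrite h //; lia.
- by rewrite h //; lia.
- by move=> j; rewrite h ?leq_addr ?orbT.
Qed.

Lemma env_agree G d d' m m' : d <= d' -> agree d m m' -> env G d m -> env G d' m'.
Proof.
move=> dd h e v r vr; have [mr rd] := e _ _ vr.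
by rewrite h ?rd //; split=> //; exact: leq_trans dd.
Qed.

Lemma fits_lt d e : fits d e -> d < B.
Proof.
elim: e d => //= [a IHa b _|a IHa b _|f _] d; try by case/andP=> /IHa.
by case/andP; lia.
Qed.

Lemma compile_ok G e e' : wf G e e' ->
  forall d m s o, 6 <= d -> base m -> env G d m -> fits d e' ->
  exists t m', [/\ bigstep (compile d e') (m, s, o) t (m', s, o), t <= cost d e' N,
    m' d = eval N M e & agree d m m'].
Proof.
elim=> {G e e'} /=.
- move=> G v d m s o d6 mB eG dB; exists 1, (upd m d v); split=> //.
  + exact: bs_op.
  + by rewrite /upd eqxx.
  + exact: agree_upd.
- move=> G v r vr d m s o d6 mB eG dB; exists 1, (upd m d (m r + m 0)); split=> //.
  + exact: bs_op.
  + by have [[-> _ _] _ _] := mB; have [-> _] := eG _ _ vr; rewrite /upd eqxx addn0.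
  + exact: agree_upd.
- move=> G a b a' b' _ IHa _ IHb d m s o d6 mB eG /andP[fa fb].
  have [ta [ma [bsa tta va ga]]] := IHa d m s o d6 mB eG fa.
  have [tb [mb [bsb ttb vb gb]]] := IHb d.+1 ma s o (leqW d6)
    (base_agree d6 ga mB) (env_agree (leqnSn _) ga eG) fb.
  exists (ta + (tb + 1)), (upd mb d (mb d + mb d.+1)); split.
  + by apply: bs_sq bsa _; apply: bs_sq bsb _; exact: bs_op.
  + lia.
  + by rewrite /upd eqxx vb gb ?ltnSn // va.
  + apply: agree_trans (leqnn d) _ (agree_upd _ _ (leqnn d) (fits_lt fa)).
    exact: agree_trans (leqnSn d) ga gb.
- move=> G a b a' b' _ IHa _ IHb d m s o d6 mB eG /andP[fa fb].
  have [ta [ma [bsa tta va ga]]] := IHa d m s o d6 mB eG fa.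
  have [tb [mb [bsb ttb vb gb]]] := IHb d.+1 ma s o (leqW d6)
    (base_agree d6 ga mB) (env_agree (leqnSn _) ga eG) fb.
  exists (ta + (tb + 1)), (upd mb d (mb d - mb d.+1)); split.
  + by apply: bs_sq bsa _; apply: bs_sq bsb _; exact: bs_op.
  + lia.
  + by rewrite /upd eqxx vb gb ?ltnSn // va.
  + apply: agree_trans (leqnn d) _ (agree_upd _ _ (leqnn d) (fits_lt fa)).
    exact: agree_trans (leqnSn d) ga gb.
- move=> G a a' _ IH d m s o d6 mB eG fa.
  have [ta [ma [bsa tta va ga]]] := IH d m s o d6 mB eG fa.
  have [_ m5 mM] := base_agree d6 ga mB.
  pose m1 := upd ma d (ma d + ma 5).
  exists (ta + (1 + 1)), (upd m1 d (m1 (m1 d))); split.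
  + by apply: bs_sq bsa _; apply: bs_sq; exact: bs_op.
  + lia.
  + have dB := fits_lt fa; rewrite /m1 /upd !eqxx m5 va addnC.
    by rewrite (_ : (B + _ == d) = false) ?mM //; apply/eqP; lia.
  + have dB := fits_lt fa; apply: agree_trans (leqnn d) _ (agree_upd _ _ (leqnn d) dB).
    exact: agree_trans (leqnn d) ga (agree_upd _ _ (leqnn d) dB).
- move=> G f f' _ IH d m s o d6 mB eG /andP[dB fb].
  pose I j (st : state) := [/\ st.1.1 d = \sum_(x < j) eval N M (f x),
    st.1.2 = s, st.2 = o & agree d m st.1.1].
  have [|j st [_ _ _ g]|j m1 m2 s' o' [mj es eo g] h|j [[m1 s'] o'] jN [/= mj es eo g] m1j||t [[[m' s'] o'] [bs tt [vd es eo g]]]] :=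
    @loop_ok d.+1 (Sq (compile d.+3 (f' d.+1)) (Op (Add d d d.+3))) N
      (cost d.+3 (f' d.+1) N + 1) I _ _ _ _ (upd m d 0, s, o).
  + lia.
  + by have [] := base_agree d6 g mB.
  + split=> //=.
      by rewrite h ?ltn_eqF.
    move=> r hr; rewrite h; [exact: g|..]; apply/eqP => e; subst; lia.
  + subst s' o'.
    have [||||t [m2 [bs tt v2 g2]]] := IH j d.+1 d.+3 m1 s o.
    * lia.
    * exact: base_agree g mB.
    * move=> v r; rewrite inE => /orP[/eqP[-> ->]|vr]; first by split=> //; lia.
      by have [? ?] := env_agree (leqnn d) g eG vr; split=> //; lia.
    * exact: fb.
    exists (t + 1), (upd m2 d (m2 d + m2 d.+3), s, o); split.
    * by apply: bs_sq bs _; exact: bs_op.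
    * lia.
    * split=> //=; last first.
        apply: agree_trans (leqnn d) _ (agree_upd _ _ (leqnn d) _); last lia.
        by apply: agree_trans g g2; lia.
      by rewrite /upd eqxx v2 g2 ?mj ?big_ord_recr //=; lia.
    * by rewrite /= /upd gtn_eqF // g2 //; lia.
  + split=> //=; first by rewrite /upd eqxx big_ord0.
    by apply: agree_upd => //; lia.
  exists (1 + t), m'; rewrite /= in vd es eo g; subst s' o'; split=> //; last lia.
  by apply: bs_sq bs; exact: bs_op.
Qed.

Lemma compile_cmd_ok G c c' : wf_cmd G c c' ->
  forall d m s o, 6 <= d -> base m -> env G d m -> fits_cmd d c' ->
  exists t m', [/\ bigstep (compile_cmd d c') (m, s, o) t (m', s, o ++ output N M c),
    t <= cost_cmd d c' N & agree d m m'].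
Proof.
elim=> {G c c'} /=.
- move=> G d m s o d6 mB eG dB; exists 1, (upd m d 0); split=> //.
  + by rewrite cats0; exact: bs_op.
  + exact: agree_upd.
- move=> G e e' we d m s o d6 mB eG fe.
  have [t [m' [bs tt v g]]] := compile_ok we s o d6 mB eG fe.
  exists (t + 1), m'; split=> //; last lia.
  by apply: bs_sq bs _; rewrite -v cats1; exact: bs_op.
- move=> G a b a' b' _ IHa _ IHb d m s o d6 mB eG /andP[fa fb].
  have [ta [ma [bsa tta ga]]] := IHa d m s o d6 mB eG fa.
  have [tb [mb [bsb ttb gb]]] := IHb d ma s (o ++ output N M a) d6
    (base_agree d6 ga mB) (env_agree (leqnn _) ga eG) fb.
  exists (ta + tb), mb; split; last 2 first.
  + lia.
  + exact: agree_trans (leqnn d) ga gb.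
  by rewrite catA; apply: bs_sq bsa bsb.
- move=> G e e' a b a' b' we _ IHa _ IHb d m s o d6 mB eG /and3P[fe fa fb].
  have [t [m1 [bs tt v g]]] := compile_ok we s o d6 mB eG fe.
  have mB1 := base_agree d6 g mB; have eG1 := env_agree (leqnn d) g eG.
  case: (eqVneq (eval N M e) 0) => ev.
    have [tb [mb [bsb ttb gb]]] := IHb d m1 s o d6 mB1 eG1 fb.
    exists (t + tb.+1), mb; split; [|lia|exact: agree_trans (leqnn d) g gb].
    by apply: bs_sq bs _; apply: bs_br0 bsb; rewrite /= v.
  have [ta [ma [bsa tta ga]]] := IHa d m1 s o d6 mB1 eG1 fa.
  exists (t + ta.+2), ma; split; [|lia|exact: agree_trans (leqnn d) g ga].
  apply: bs_sq bs _; apply: bs_br1 bsa _; first by rewrite /= v.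
  by have [[]] := base_agree d6 ga mB1.
- move=> G f f' _ IH d m s o d6 mB eG /andP[dB fb].
  pose I j (st : state) := [/\ st.2 = o ++ flatten [seq output N M (f x) | x <- iota 0 j],
    st.1.2 = s & agree d m st.1.1].
  have [|j st [_ _ g]|j m1 m2 s' o' [eo es g] h|j [[m1 s'] o'] jN [/= eo es g] m1j||t [[[m' s'] o'] [bs tt [eo es g]]]] :=
    @loop_ok d (compile_cmd d.+2 (f' d)) N (cost_cmd d.+2 (f' d) N) I _ _ _ _ (m, s, o).
  + lia.
  + by have [] := base_agree d6 g mB.
  + split=> //= r hr; rewrite h; [exact: g|..]; apply/eqP => e; subst; lia.
  + subst s' o'.
    have [||||t [m2 [bs tt g2]]] := IH j d d.+2 m1 s (o ++ flatten [seq output N M (f x) | x <- iota 0 j]).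
    * lia.
    * exact: base_agree g mB.
    * move=> v r; rewrite inE => /orP[/eqP[-> ->]|vr]; first by split=> //; lia.
      by have [? ?] := env_agree (leqnn d) g eG vr; split=> //; lia.
    * exact: fb.
    exists t, (m2, s, (o ++ flatten [seq output N M (f x) | x <- iota 0 j]) ++ output N M (f j)).
    split=> //=; last by rewrite g2 //; lia.
    split=> //; last by apply: agree_trans g g2; lia.
    by rewrite -addn1 iotaD map_cat flatten_cat /= cats0 catA.
  + by split=> //=; rewrite cats0.
  exists t, m'; rewrite /= in eo es g; subst s' o'; split=> //.
Qed.

End Compiler.

Section Prelude.
Variable B : nat.
Hypothesis B12 : 12 <= B.

Definition prelude : code :=
  Sq (Op (Const 1 1)) (Sq (Op (Read 2)) (Sq (Op (Read 3)) (Sq (Op (Read 4))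
  (Sq (Op (Const 5 B)) (Sq (Op (Const 6 B))
  (loop 7 (loop 9 (Sq (Op (Read 11)) (Sq (Op (Store 6 11)) (Op (Add 6 6 1))))))))))).

Variables (N k eta : nat) (w : seq nat).
Hypothesis size_w : size w = N * N.

Definition loaded (p : nat) (st : state) : Prop :=
  let m := st.1.1 in
  [/\ consts N m, [/\ m 3 = k, m 4 = eta & m 5 = B], m 6 = B + p,
      st.1.2 = drop p w /\ st.2 = [::]
    & forall j, m (B + j) = if j < p then nth 0 w j else 0].

Lemma loaded_frame p m m' s o : loaded p (m, s, o) ->
  (forall r, (r < 7) || (B <= r) -> m' r = m r) -> loaded p (m', s, o).
Proof.
move=> [/= [m0 m1 m2] [m3 m4 m5] m6 [es eo] mB] h; split=> //=.
- by split; rewrite h.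
- by split; rewrite h.
- by rewrite h.
- by move=> j; rewrite h ?leq_addr ?orbT.
Qed.

Lemma loaded_step p m s o : loaded p (m, s, o) ->
  exists m', [/\ bigstep (Sq (Op (Read 11)) (Sq (Op (Store 6 11)) (Op (Add 6 6 1))))
    (m, s, o) 3 (m', behead s, o), loaded p.+1 (m', behead s, o),
    m' 7 = m 7 & m' 9 = m 9].
Proof.
move=> [/= [m0 m1 m2] [m3 m4 m5] m6 [es eo] mB].
pose m1' := upd m 11 (head 0 s); pose m2' := upd m1' (B + p) (head 0 s).
exists (upd m2' 6 (m2' 6 + m2' 1)).
have m2E r : r != 11 -> r != B + p -> m2' r = m r.
  by move=> r1 r2; rewrite /m2' /m1' /upd (negbTE r1) (negbTE r2).
have mE r : r < 6 -> upd m2' 6 (m2' 6 + m2' 1) r = m r.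
  by move=> r6; rewrite /upd ltn_eqF // m2E // ltn_eqF //; lia.
split.
- have -> : (upd m2' 6 (m2' 6 + m2' 1), behead s, o) =
    act (Add 6 6 1) (act (Store 6 11) (act (Read 11) (m, s, o))).
    by rewrite /act /= -/m1' /m2' [m1' 6]/m1' /upd /= m6.
  by apply: (@bs_sq _ _ _ 1 _ 2); [|apply: (@bs_sq _ _ _ 1 _ 1)]; exact: bs_op.
- split=> //=.
  + by split; rewrite mE.
  + by split; rewrite mE.
  + by rewrite /upd ?eqxx /= !m2E ?m6 ?m1 //; lia.
  + by rewrite es -drop1 drop_drop add1n.
  + move=> j; rewrite /upd gtn_eqF; last lia.
    rewrite /m2' /upd eqn_add2l /m1' /upd; have [->|jp] := eqVneq j p.
      by rewrite ltnSn es -nth0 nth_drop addn0.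
    by rewrite gtn_eqF ?mB; [rewrite ltnS [j <= p]leq_eqVlt (negbTE jp)|lia].
- by rewrite /upd /= m2E //; lia.
- by rewrite /upd /= m2E //; lia.
Qed.

Lemma prelude_ok :
  exists t m', [/\ bigstep prelude (fun=> 0, [:: N, k, eta & w], [::]) t (m', [::], [::]),
    t <= N * (N * 7 + 3 + 4) + 9, base B N (nth 0 w) m' & m' 3 = k /\ m' 4 = eta].
Proof.
pose m0 := upd (upd (upd (upd (upd (upd (fun=> 0) 1 1) 2 N) 3 k) 4 eta) 5 B) 6 B.
have H0 : loaded (0 * N) (m0, w, [::]).
  split=> //=; first by rewrite addn0.
    by rewrite drop0.
  by move=> j; rewrite /m0 /upd !gtn_eqF //; lia.
have [|j m m' s o /= h f|j st jN h mj|t [[[m' s'] o'] [bs tt L]]] := @loop_ok 7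
  (loop 9 (Sq (Op (Read 11)) (Sq (Op (Store 6 11)) (Op (Add 6 6 1))))) N
  (N * (3 + 4) + 3) (fun x => loaded (x * N)) isT _ _ _ (m0, w, [::]) H0.
- by move=> j st [].
- apply: loaded_frame h _ => r hr; apply: f; apply/eqP => e; subst; lia.
- have [|x m m' s o /= [h' e7] f|x [[m s] o] xN [L /= e7] e9||t [st' [bs tt [L e7]]]] := @loop_ok 9
    (Sq (Op (Read 11)) (Sq (Op (Store 6 11)) (Op (Add 6 6 1)))) N 3
    (fun y st => loaded (j * N + y) st /\ st.1.1 7 = j) isT _ _ _ st.
  + by move=> x st0 [[]].
  + split; last by rewrite f.
    by apply: loaded_frame h' _ => r hr; apply: f; apply/eqP => e; subst; lia.
  + have [m' [bs L' e7' e9']] := loaded_step L.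
    exists 3, (m', behead s, o); split=> //; rewrite /= ?e9' //.
    by rewrite addnS e7'.
  + by rewrite addn0.
  exists t, st'; split=> //.
  by rewrite mulSn addnC.
have [cs [m3 m4 m5] m6 [es eo] mB] := L; rewrite /= in es eo m3 m4 m5 mB cs.
rewrite drop_oversize ?size_w // in es; subst s' o'.
exists (1 + (1 + (1 + (1 + (1 + (1 + t)))))), m'; split=> //; last first.
- split=> // j; rewrite mB; case: ltnP => // h.
  by rewrite nth_default ?size_w.
- by move: tt; lia.
do 6 (apply: bs_sq; first exact: bs_op).
exact: bs.
Qed.

End Prelude.

Definition polyfun (f : nat -> nat) : Prop :=
  exists P : {poly nat}, forall N, f N = (P.[N])%R.

Lemma polyfun_const v : polyfun (fun=> v).
Proof. by exists (polyC v) => N; rewrite hornerC. Qed.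

Lemma polyfun_id : polyfun id.
Proof. by exists 'X%R => N; rewrite hornerX. Qed.

Lemma polyfun_add f g : polyfun f -> polyfun g -> polyfun (fun N => f N + g N).
Proof. by move=> [P eP] [Q eQ]; exists (P + Q)%R => N; rewrite hornerD eP eQ. Qed.

Lemma polyfun_mul f g : polyfun f -> polyfun g -> polyfun (fun N => f N * g N).
Proof. by move=> [P eP] [Q eQ]; exists (P * Q)%R => N; rewrite hornerM eP eQ. Qed.

Ltac polyfun_tac := repeat first
  [exact: polyfun_const | exact: polyfun_id | assumption
  | apply: polyfun_add | apply: polyfun_mul].

Lemma polyfun_cost d e : polyfun (cost d e).
Proof.
elim: e d => [v|x|a IHa b IHb|a IHa b IHb|a IHa|f IHf] d /=;
  polyfun_tac; by [exact: IHa|exact: IHb|exact: IHf].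
Qed.

Lemma polyfun_cost_cmd d c : polyfun (cost_cmd d c).
Proof.
elim: c d => [|e|a IHa b IHb|e a IHa b IHb|f IHf] d /=;
  polyfun_tac; by [exact: IHa|exact: IHb|exact: IHf|exact: polyfun_cost].
Qed.

Lemma leq_horner (P : {poly nat}) m n : m <= n -> (P.[m] <= P.[n])%N%R.
Proof.
move=> mn; elim/poly_ind: P => [|P c IH]; first by rewrite !horner0.
by rewrite !hornerMXaddC; apply: leq_add => //; apply: leq_mul.
Qed.

Definition matrix_of (I : bcd_instance) : seq nat :=
  [seq nat_of_bool (adj (graph I) x y)
      | x <- enum 'I_(nvert I), y <- enum 'I_(nvert I)].

Lemma leq_nvert_input_size I : nvert I <= input_size (encode I).
Proof.
have le s : size s <= input_size s.
  by rewrite /input_size; elim: s => //= x s IH; rewrite -add1n; apply: leq_add.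
apply: leq_trans (le _); rewrite /= size_allpairs !size_enum_ord; nia.
Qed.

Lemma polytime_program (B : nat) (prog : forall V : Type, V -> V -> cmd V)
  (f : bcd_instance -> bcd_instance) :
  12 <= B ->
  (forall vk ve, wf_cmd [:: (vk, 3); (ve, 4)] (prog nat vk ve) (prog nat 3 4)) ->
  fits_cmd B 7 (prog nat 3 4) ->
  (forall I, output (nvert I) (nth 0 (matrix_of I)) (prog nat (param I) (slack I))
             = encode (f I)) ->
  polytime f.
Proof.
move=> B12 wfp fp outp.
pose A := asm 0 (Sq (prelude B) (compile_cmd 7 (prog nat 3 4))).
have [P eP] : polyfun (fun N => (N * (N * 7 + 3 + 4) + 9) + cost_cmd 7 (prog nat 3 4) N).
  by have := polyfun_cost_cmd 7 (prog nat 3 4); move=> ?; polyfun_tac.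
exists A, P => I c.
have sw : size (matrix_of I) = nvert I * nvert I by rewrite size_allpairs !size_enum_ord.
have [t1 [m1 [bs1 tt1 b1 [m3 m4]]]] := prelude_ok B12 (param I) (slack I) sw.
have e1 : env [:: (param I, 3); (slack I, 4)] 7 m1.
  by move=> v r; rewrite !inE => /orP[]/eqP[-> ->].
have [t2 [m2 [bs2 tt2 _]]] :=
  compile_cmd_ok (wfp (param I) (slack I)) [::] [::] (isT : 6 <= 7) b1 e1 fp.
have := bigstep_run (bs_sq bs1 bs2) (A := A) (l := 0).
have sg : segment A 0 (asm 0 (Sq (prelude B) (compile_cmd 7 (prog nat 3 4)))).
  by exists [::], [::]; rewrite cats0.
move=> /(_ sg) run12; rewrite outp in run12.
have tP : t1 + t2 <= (P.[input_size (encode I)])%R.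
  apply: leq_trans (leq_horner P (leq_nvert_input_size I)); rewrite -eP.
  exact: leq_add.
have stop x : halted A x -> step A x = x.
  by rewrite /halted /step => /onth_default ->.
have stops j x : halted A x -> iter j (step A) x = x.
  by move=> hx; elim: j => //= j ->; exact: stop.
have cE : c = at_pc (size A) (m2, [::], encode (f I)).
  rewrite /c /run -(subnK tP) iterD.
  rewrite -[init _]/(at_pc 0 (fun=> 0, encode I, [::])).
  rewrite [encode I]/= run12 stops ?size_asm //.
  by rewrite /halted /= /A size_asm.
by rewrite cE; split=> //; rewrite /halted /=.
Qed.

(** * The kernelization program *)

(* Booleans are the numbers 0 and 1. *)
Section Macros.
Variable V : Type.
Implicit Types a b : exp V.

Definition neg_e a := Minus (Cst 1) a.
Definition pos_e a := neg_e (neg_e a).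
Definition le_e a b := neg_e (Minus a b).
Definition lt_e a b := le_e (Plus a (Cst 1)) b.
Definition eq_e a b := neg_e (Plus (Minus a b) (Minus b a)).
Definition and_e a b := Minus (Plus a b) (Cst 1).
Definition or_e a b := pos_e (Plus a b).
Definition xor_e a b := Plus (Minus a b) (Minus b a).

Variables k eta : V.

Definition c_e := Plus (Var k) (Var k).
Definition thr_e := Plus (Plus c_e c_e) (Cst 3).
Definition adj_e (u w : V) := Mat (Plus (Sum (fun=> Var u)) (Var w)).
Definition sdiff_e (R : V -> V -> exp V) (u w : V) :=
  Sum (fun z => xor_e (R u z) (R w z)).
Definition pruned_e (u w : V) :=
  and_e (adj_e u w) (le_e (sdiff_e adj_e u w) (Plus c_e (Cst 2))).
Definition forced_e := Sum (fun u => Sum (fun w => and_e (lt_e (Var u) (Var w))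
  (and_e (adj_e u w) (neg_e (pruned_e u w))))).
Definition in_clique_e (v : V) := neg_e (Sum (fun u =>
  and_e (pruned_e v u) (lt_e (Cst 2) (sdiff_e pruned_e v u)))).
Definition csize_e (v : V) := Plus (Sum (pruned_e v)) (Cst 1).
Definition huge_e (v : V) := and_e (in_clique_e v) (le_e thr_e (csize_e v)).
Definition cap_e (v : V) := Minus (csize_e v) (Minus (csize_e v) thr_e).
Definition excess_e := Sum (fun j => pos_e (Sum (fun v =>
  and_e (in_clique_e v) (lt_e (Plus thr_e (Var j)) (csize_e v))))).
Definition nonclique_e := Sum (fun v => neg_e (in_clique_e v)).
Definition unbalanced_e := pos_e (Sum (fun u => Sum (fun v =>
  and_e (huge_e u) (and_e (huge_e v)
    (lt_e (Plus (csize_e v) (Var eta)) (csize_e u)))))).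
Definition square_thr_e :=
  Sum (fun x => Sum (fun y => and_e (lt_e (Var x) thr_e) (lt_e (Var y) thr_e))).
Definition infeasible_e := or_e (lt_e (Var k) forced_e)
  (or_e (lt_e square_thr_e nonclique_e) unbalanced_e).
Definition pos_in_clique_e (v : V) :=
  Sum (fun w => and_e (lt_e (Var w) (Var v)) (pruned_e v w)).
Definition before_e (u v : V) := neg_e (Sum (fun w =>
  and_e (le_e (Var w) (Var u)) (or_e (eq_e (Var w) (Var v)) (pruned_e v w)))).
Definition rk_e (v : V) := Sum (fun u => and_e (in_clique_e u)
  (and_e (neg_e (pos_in_clique_e u)) (and_e (eq_e (cap_e u) (cap_e v)) (before_e u v)))).
Definition kept_e (v : V) := or_e (neg_e (in_clique_e v))
  (and_e (le_e (rk_e v) c_e) (lt_e (pos_in_clique_e v) thr_e)).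

Definition write_constants (s : seq nat) : cmd V :=
  foldr (fun v => Then (Wr (Cst v))) Skip s.

Definition kernel_prog : cmd V :=
  If infeasible_e (write_constants [:: 3; 0; 0; 0; 1; 0; 1; 0; 1; 0; 1; 0])
    (Then (Wr (Sum kept_e))
    (Then (Wr (Minus (Var k) forced_e))
    (Then (Wr (Minus (Var eta) excess_e))
      (For (fun x => If (kept_e x)
        (For (fun y => If (kept_e y) (Wr (pruned_e x y)) Skip)) Skip))))).

End Macros.

Ltac wf_tac := repeat (intros; first
  [ apply: wf_cst | apply: wf_var; rewrite !inE ?eqxx ?orbT //
  | apply: wf_plus | apply: wf_minus | apply: wf_mat | apply: wf_sum
  | apply: wf_cmd_skip | apply: wf_cmd_wr | apply: wf_cmd_then | apply: wf_cmd_if | apply: wf_cmd_for]).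

Lemma wf_kernel vk ve :
  wf_cmd [:: (vk, 3); (ve, 4)] (kernel_prog vk ve) (kernel_prog 3 4).
Proof. wf_tac. Qed.

Lemma fits_kernel : fits_cmd 100 7 (kernel_prog 3 4).
Proof. by vm_compute. Qed.

Lemma card_eq0_forall (T : finType) (P Q : pred T) :
  (#|[set w | P w && Q w]| == 0) = [forall w, P w ==> ~~ Q w].
Proof.
rewrite cards_eq0; apply/eqP/forallP => [/setP h w|h].
  by have := h w; rewrite !inE; case: (P w) => //= ->.
by apply/setP=> w; rewrite !inE; have := h w; case: (P w) => //= /negbTE.
Qed.

Section Eval.
Variables (N : nat) (M : nat -> nat).
Local Notation ev := (eval N M).

Lemma eval_neg a (p : bool) : ev a = p -> ev (neg_e a) = ~~ p.
Proof. by rewrite /= => ->; case: p. Qed.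

Lemma eval_neg0 a : ev (neg_e a) = (ev a == 0).
Proof. by rewrite /=; case: (ev a). Qed.

Lemma eval_pos a : ev (pos_e a) = (0 < ev a).
Proof. by rewrite /=; case: (ev a). Qed.

Lemma eval_le a b : ev (le_e a b) = (ev a <= ev b).
Proof. by rewrite /=; case: leqP => h; lia. Qed.

Lemma eval_lt a b : ev (lt_e a b) = (ev a < ev b).
Proof. by rewrite eval_le /= addn1. Qed.

Lemma eval_eq a b : ev (eq_e a b) = (ev a == ev b).
Proof. by rewrite /=; case: eqP => h; lia. Qed.

Lemma eval_and a b (p q : bool) : ev a = p -> ev b = q -> ev (and_e a b) = p && q.
Proof. by rewrite /= => -> ->; case: p; case: q. Qed.

Lemma eval_or a b (p q : bool) : ev a = p -> ev b = q -> ev (or_e a b) = p || q.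
Proof. by rewrite /= => -> ->; case: p; case: q. Qed.

Lemma eval_xor a b (p q : bool) : ev a = p -> ev b = q -> ev (xor_e a b) = p (+) q.
Proof. by rewrite /= => -> ->; case: p; case: q. Qed.

Lemma eval_sum (f : nat -> exp nat) (P : pred 'I_N) : (forall x : 'I_N, ev (f x) = P x) ->
  ev (Sum f) = #|[set x | P x]|.
Proof.
move=> fP; rewrite /= (eq_bigr (fun x : 'I_N => nat_of_bool (P x))) //.
by rewrite cardsE -sum1_card [RHS]big_mkcond; apply: eq_bigr => x _; rewrite unfold_in; case: (P x).
Qed.

Lemma eval_sum2 (f : nat -> nat -> exp nat) (P : rel 'I_N) : (forall x y : 'I_N, ev (f x y) = P x y) ->
  ev (Sum (fun x => Sum (f x))) = #|[set p : 'I_N * 'I_N | P p.1 p.2]|.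
Proof.
move=> fP; rewrite /= (eq_bigr (fun x : 'I_N => \sum_(y < N) nat_of_bool (P x y))).
  rewrite pair_big /= cardsE -sum1_card [RHS]big_mkcond /= .
  by apply: eq_bigr => -[x y] _; rewrite unfold_in /=; case: (P x y).
by move=> x _; apply: eq_bigr => y _.
Qed.

Variables (A : rel 'I_N) (k eta : nat).
Hypothesis MA : forall x y : 'I_N, M (x * N + y) = A x y.

Local Notation B := (pruned k A).

Lemma eval_c : ev (c_e k) = k.*2.
Proof. by rewrite /= addnn. Qed.

Lemma eval_thr : ev (thr_e k) = threshold k.*2.
Proof. by rewrite /= !addnn addn3. Qed.

Lemma eval_adj (u w : 'I_N) : ev (@adj_e nat u w) = A u w.
Proof. by rewrite /= sum_nat_const card_ord mulnC MA. Qed.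

Lemma eval_sdiff (f : nat -> nat -> exp nat) (R : rel 'I_N) :
  (forall u w : 'I_N, ev (f u w) = R u w) ->
  forall u w : 'I_N, ev (sdiff_e f u w) = sdiff R u w.
Proof. by move=> fR u w; apply: eval_sum => z; apply: eval_xor. Qed.

Lemma eval_pruned (u w : 'I_N) : ev (pruned_e k u w) = B u w.
Proof.
apply: eval_and; first exact: eval_adj.
rewrite eval_le (eval_sdiff eval_adj) -[ev _]/(ev (c_e k) + 2) eval_c.
by rewrite addn2.
Qed.

Lemma eval_forced : ev (forced_e k) = forced k A.
Proof.
apply: (eval_sum2 (P := fun u w : 'I_N => (u < w) && (A u w && ~~ B u w))) => u w.
apply: eval_and; first exact: eval_lt.
by apply: eval_and; [exact: eval_adj|apply: eval_neg; exact: eval_pruned].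
Qed.

Lemma eval_in_clique (v : 'I_N) : ev (in_clique_e k v) = in_clique B v.
Proof.
rewrite eval_neg0 (eval_sum (P := fun u => B v u && (2 < sdiff B v u))) // => u.
apply: eval_and; first exact: eval_pruned.
by rewrite eval_lt (eval_sdiff eval_pruned).
Qed.

Lemma eval_csize (v : 'I_N) : ev (csize_e k v) = csize B v.
Proof.
rewrite -[ev _]/(ev (Sum (pruned_e k v)) + 1) (eval_sum (P := B v)) ?addn1 // => u.
exact: eval_pruned.
Qed.

Lemma eval_huge (v : 'I_N) : ev (huge_e k v) = huge_clique k.*2 B v.
Proof.
by apply: eval_and; [exact: eval_in_clique|rewrite eval_le eval_thr eval_csize].
Qed.

Lemma eval_cap (v : 'I_N) : ev (cap_e k v) = cap k.*2 B v.
Proof.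
rewrite -[ev _]/(ev (csize_e k v) - (ev (csize_e k v) - ev (thr_e k))).
by rewrite eval_csize eval_thr /cap; lia.
Qed.

Lemma eval_excess : ev (excess_e k) = excess k.*2 B.
Proof.
apply: eval_sum => j; rewrite eval_pos; congr nat_of_bool.
rewrite (eval_sum (P := fun v => in_clique B v && (threshold k.*2 + j < csize B v))).
  apply/card_gt0P/existsP => -[v]; first by rewrite inE; exists v.
  by exists v; rewrite inE.
move=> v; apply: eval_and; first exact: eval_in_clique.
by rewrite eval_lt -[ev (Plus _ _)]/(ev (thr_e k) + j) eval_thr eval_csize.
Qed.

Lemma eval_nonclique : ev (nonclique_e k) = #|nonclique B|.
Proof. by apply: eval_sum => v; apply: eval_neg; exact: eval_in_clique. Qed.

Lemma eval_unbalanced : ev (unbalanced_e k eta) = unbalanced k.*2 eta B.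
Proof.
rewrite eval_pos; congr nat_of_bool.
rewrite (eval_sum2 (P := fun u v =>
  [&& huge_clique k.*2 B u, huge_clique k.*2 B v & csize B v + eta < csize B u])).
  apply/card_gt0P/existsP => [[[u v]]|[u /existsP[v h]]].
    by rewrite inE => h; exists u; apply/existsP; exists v.
  by exists (u, v); rewrite inE.
move=> u v; apply: eval_and; first exact: eval_huge.
apply: eval_and; first exact: eval_huge.
by rewrite eval_lt -[ev (Plus _ _)]/(ev (csize_e k v) + eta) !eval_csize.
Qed.

Lemma eval_square_thr :
  ev (square_thr_e k) = minn (threshold k.*2) N * minn (threshold k.*2) N.
Proof.
rewrite (eval_sum2 (P := fun x y : 'I_N => (x < threshold k.*2) && (y < threshold k.*2))).
  rewrite -card_ord_lt -cardsX; apply: eq_card => -[x y].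
  by rewrite !inE.
by move=> x y; apply: eval_and; rewrite eval_lt eval_thr.
Qed.

Lemma eval_infeasible : ev (infeasible_e k eta) = infeasible k eta A.
Proof.
apply: eval_or; first by rewrite eval_lt eval_forced.
apply: eval_or; last exact: eval_unbalanced.
by rewrite eval_lt eval_square_thr eval_nonclique.
Qed.

Lemma eval_pos_in_clique (v : 'I_N) : ev (pos_in_clique_e k v) = pos B v.
Proof.
by apply: eval_sum => w; apply: eval_and; [exact: eval_lt|exact: eval_pruned].
Qed.

Lemma eval_before (u v : 'I_N) : ev (before_e k u v) = before B u v.
Proof.
rewrite eval_neg0; congr nat_of_bool.
rewrite (eval_sum (P := fun w : 'I_N => (w <= u) && ((w == v) || B v w))).
  exact: card_eq0_forall.
move=> w; apply: eval_and; first exact: eval_le.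
by apply: eval_or; [exact: eval_eq|exact: eval_pruned].
Qed.

Lemma eval_rk (v : 'I_N) : ev (rk_e k v) = rk k.*2 B v.
Proof.
apply: eval_sum => u; apply: eval_and; first exact: eval_in_clique.
apply: eval_and; last apply: eval_and.
- rewrite eval_neg0 eval_pos_in_clique; congr nat_of_bool.
  exact: card_eq0_forall.
- by rewrite eval_eq !eval_cap.
- exact: eval_before.
Qed.

Lemma eval_kept (v : 'I_N) : ev (kept_e k v) = (v \in kept k.*2 B).
Proof.
rewrite inE; apply: eval_or; first by apply: eval_neg; exact: eval_in_clique.
apply: eval_and; first by rewrite eval_le eval_rk eval_c.
by rewrite eval_lt eval_pos_in_clique eval_thr.
Qed.

End Eval.

Lemma nth_allpairs (S T R : Type) (f : S -> T -> R) x0 y0 z0 s t i j :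
  i < size s -> j < size t ->
  nth z0 [seq f x y | x <- s, y <- t] (i * size t + j) = f (nth x0 s i) (nth y0 t j).
Proof.
elim: s i => //= x s IH [|i] si jt; rewrite nth_cat size_map.
  by rewrite mul0n add0n jt (nth_map y0).
rewrite mulSn -addnA ltnNge leq_addr /= addKn.
exact: IH.
Qed.

Lemma matrix_ofE I (x y : 'I_(nvert I)) :
  nth 0 (matrix_of I) (x * nvert I + y) = adj (graph I) x y.
Proof.
have := @nth_allpairs _ _ _ (fun u v => nat_of_bool (adj (graph I) u v)) x x 0
  (enum 'I_(nvert I)) (enum 'I_(nvert I)) x y.
by rewrite !size_enum_ord !nth_ord_enum => ->.
Qed.

Lemma map_enum_val (T : finType) (S : {set T}) :
  [seq enum_val i | i <- enum 'I_#|S|] = enum S.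
Proof.
have [->|[x0 _]] := set_0Vmem S.
  by rewrite enum_set0; apply: size0nil; rewrite size_map size_enum_ord cards0.
have x1 : T := x0; apply: (@eq_from_nth _ x1).
  by rewrite size_map size_enum_ord cardE.
move=> i; rewrite size_map size_enum_ord => iS.
by rewrite (nth_map (Ordinal iS)) ?size_enum_ord // (enum_val_nth x1) nth_enum_ord.
Qed.

Lemma flatten_filter (T R : Type) (P : pred T) (f : T -> seq R) s :
  flatten [seq (if P x then f x else [::]) | x <- s] = flatten [seq f x | x <- s & P x].
Proof. by elim: s => //= x s IH; case: (P x); rewrite /= IH. Qed.

Lemma flatten_iota (R : Type) n (S : {set 'I_n}) (F : nat -> seq R) (f : 'I_n -> seq R) :
  (forall x : 'I_n, F x = if x \in S then f x else [::]) ->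
  flatten [seq F x | x <- iota 0 n] = flatten [seq f x | x <- enum S].
Proof.
move=> FE; rewrite -val_enum_ord -map_comp (eq_map FE) flatten_filter.
by rewrite {2}/enum_mem enumT.
Qed.

Definition path3 : rel 'I_3 := fun x y => (x == 1 :> nat) (+) (y == 1 :> nat).

Definition no_instance : bcd_instance := BCDInstance (graph_of_rel path3) 0 0.

Lemma path3_sym : symmetric path3.
Proof. by move=> x y; rewrite /path3 addbC. Qed.

Lemma path3_irr : irreflexive path3.
Proof. by move=> x; rewrite /path3 addbb. Qed.

Lemma no_instance_no : ~ BCD no_instance.
Proof.
move/BCD_solvable => [E [[Er Es Et EA /= Ec] _]].
have aE := adj_graph_of_rel path3_sym path3_irr.
have AE x y : path3 x y -> E x y.
  move=> xy; apply: contraLR Ec => nE; rewrite -ltnNge; apply/card_gt0P.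
  by exists (x, y); rewrite !inE nE /= aE xy.
have := EA ord0 (inord 2); rewrite aE /path3 inordK // => H.
suff : false by []; apply: H; last by apply/eqP => /(congr1 val); rewrite /= inordK.
by apply: (Et (inord 1)); apply: AE; rewrite /path3 !inordK.
Qed.

Lemma encode_no_instance :
  encode no_instance = [:: 3; 0; 0; 0; 1; 0; 1; 0; 1; 0; 1; 0].
Proof.
rewrite /encode /=; do 3 congr (_ :: _).
pose g (x y : nat) := nat_of_bool ((x == 1) (+) (y == 1)).
transitivity [seq g x y | x <- iota 0 3, y <- iota 0 3]; last by [].
rewrite -val_enum_ord allpairs_mapl.
rewrite (allpairs_mapr (fun x y => g (val x) y) (fun=> val)).
by apply: eq_allpairs => x y; rewrite adj_graph_of_rel //; [exact: path3_sym|exact: path3_irr].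
Qed.

Lemma output_wr N M e : output N M (Wr e) = [:: eval N M e].
Proof. by []. Qed.

Lemma output_then N M a b : output N M (Then a b) = output N M a ++ output N M b.
Proof. by []. Qed.

Lemma output_if N M e a b : output N M (If e a b) =
  if eval N M e == 0 then output N M b else output N M a.
Proof. by []. Qed.

Lemma output_for N M f : output N M (For f) =
  flatten [seq output N M (f x) | x <- iota 0 N].
Proof. by []. Qed.

Section Kernel.
Variable I : bcd_instance.
Let A := adj (graph I).
Let B := pruned (param I) A.
Let S := kept (param I).*2 B.

Definition reduced : bcd_instance :=
  BCDInstance (graph_of_rel (fun i j : 'I_#|S| => B (enum_val i) (enum_val j)))
    (param I - forced (param I) A) (slack I - excess (param I).*2 B).

Definition kernel : bcd_instance :=
  if infeasible (param I) (slack I) A then no_instance else reduced.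

Lemma reduced_adj : adj (graph reduced) =2 (fun i j => B (enum_val i) (enum_val j)).
Proof.
apply: adj_graph_of_rel => [i j|i]; first exact: pruned_sym (adj_sym _) _ _.
exact: pruned_irr (adj_irr _) _.
Qed.

Lemma kernel_BCD : BCD kernel <-> BCD I.
Proof.
rewrite /kernel; case: ifP => inf.
  split=> [/no_instance_no//|/BCD_solvable h].
  by case: (infeasible_unsolvable (@adj_sym _ _) (@adj_irr _ _) inf h).
rewrite (BCD_solvable I).
rewrite -(solvable_reduced (@adj_sym _ _) (@adj_irr _ _) (negbT inf)).
rewrite BCD_solvable; apply: iff_trans (solvable_restrict _ _ _ _).
by split; apply: solvable_ext => i j; rewrite reduced_adj.
Qed.

Lemma output_kernel :
  output (nvert I) (nth 0 (matrix_of I)) (kernel_prog (param I) (slack I))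
  = encode kernel.
Proof.
have MA := @matrix_ofE I; rewrite /kernel.
have kE := eval_kept (param I) MA.
rewrite /kernel_prog output_if (eval_infeasible _ _ MA) eqb0 if_neg.
case: ifP => inf; first by rewrite encode_no_instance.
rewrite !output_then !output_wr output_for (eval_sum (P := mem S)); last exact: kE.
rewrite -[eval _ _ (Minus _ _)]/(param I - eval _ _ (forced_e (param I))) (eval_forced _ MA).
rewrite -[eval _ _ (Minus _ _)]/(slack I - eval _ _ (excess_e (param I))) (eval_excess _ MA).
rewrite (flatten_iota (S := S)
  (f := fun x => flatten [seq [:: nat_of_bool (B x y)] | y <- enum S])); last first.
  move=> x; rewrite output_if kE eqb0 if_neg; case: ifP => // xS.
  rewrite output_for; apply: flatten_iota => y.
  rewrite output_if kE eqb0 if_neg; case: ifP => // yS.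
  by rewrite output_wr (eval_pruned _ MA).
rewrite /encode /= cardsE; congr [:: _, _, _ & _].
rewrite -(map_enum_val S) -map_comp; congr flatten; apply: eq_map => i /=.
rewrite flatten_map1 -map_comp; apply: eq_map => j /=.
by rewrite -[RHS]/(nat_of_bool (adj (graph reduced) i j)) reduced_adj.
Qed.

Lemma nvert_kernel :
  nvert kernel <= 3 + (threshold (param I).*2 * threshold (param I).*2 +
    (threshold (param I).*2).+1 * (param I).*2.+1 * threshold (param I).*2).
Proof.
rewrite /kernel; case: ifP => [_|/negbT inf]; first exact: leq_addr.
apply: leq_trans (leq_addl _ _); exact: card_reduced (@adj_sym _ _) (@adj_irr _ _) inf.
Qed.

Lemma param_kernel : param kernel <= param I.
Proof. by rewrite /kernel; case: ifP => // _; exact: leq_subr. Qed.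

End Kernel.

Theorem mainTheorem2 :
  exists (K : bcd_instance -> bcd_instance) (g : nat -> nat),
    [/\ polytime K,
        bigO g (fun k => k ^ 4)
      & forall I : bcd_instance,
          [/\ BCD (K I) <-> BCD I,
              nvert (K I) <= g (param I)
            & param (K I) <= param I]].
Proof.
exists kernel, (fun k => 3 + (threshold k.*2 * threshold k.*2 + (threshold k.*2).+1 * k.*2.+1 * threshold k.*2)).
split; last by move=> I; split; [exact: kernel_BCD|exact: nvert_kernel|exact: param_kernel].
- exact: (polytime_program (B := 100) (prog := kernel_prog) isT wf_kernel fits_kernel output_kernel).
exists 220, 1 => k k1.
have t7 : threshold k.*2 <= 7 * k by rewrite /threshold; lia.
have t8 : (threshold k.*2).+1 <= 8 * k by rewrite /threshold; lia.
have c3 : k.*2.+1 <= 3 * k by lia.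
have h2 : threshold k.*2 * threshold k.*2 <= 49 * k ^ 4.
  apply: leq_trans (leq_mul t7 t7) _; rewrite mulnACA leq_mul2l /=.
  by rewrite mulnn leq_pexp2l.
have h3 : (threshold k.*2).+1 * k.*2.+1 * threshold k.*2 <= 168 * k ^ 4.
  apply: leq_trans (leq_mul (leq_mul t8 c3) t7) _.
  by rewrite [8 * k * _]mulnACA mulnACA leq_mul2l /= mulnn -expnSr leq_pexp2l.
have k4 : 0 < k ^ 4 by rewrite expn_gt0 k1.
lia.
Qed.
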